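(* Let $1<t_0<N_0$ be integers, let $\alpha=\frac{\log t_0}{\log N_0}\in(0,1)$, and let $1\le p,q<\infty$ satisfy $$p<\frac{q(2-\alpha)}{\alpha(q-1)}$$ (for $q=1$ the right-hand side is read as $+\infty$). Then there are a Cantor system with parameters $N_0,t_0,n_0$ for some positive integer $n_0$ (as defined in the context) satisfying the Fourier decay conditions (D1) and (D2) of the context for every $0<\beta<\alpha$, such that the associated measure $\mu$ on $[0,1]$ and functions $f_\ell=\mathbf{1}_{F_\ell}$, $\ell\in\mathbb{N}$, satisfy $$\frac{\|\widehat{f_\ell\,d\mu}\|_{L^p(\mathbb{R})}}{\|f_\ell\|_{L^q(d\mu)}}\to\infty\quad\text{as }\ell\to\infty .$$
   Context: Cantor system with parameters $N_0,t_0,n_0$: put $N=N_0^{2n_0}$, $t=t_0^{2n_0}$ (so $\log t/\log N=\alpha$) and $[N]=\{0,1,\dots,N-1\}$. Let $P\subset[N]$ be an arithmetic progression of length $t^{1/2}=t_0^{n_0}$. Sets $A_0,A_1,\dots$ satisfy $A_0=\{0\}$ and $A_{j+1}=\bigcup_{a\in A_j}(a+A_{j+1,a})$ with $A_{j+1,a}\subset N^{-(j+1)}[N]$ and $|A_{j+1,a}|=t$ for each $a\in A_j$. Sets $P_j$ are defined by $P_0=\{0\}$, $P_{j+1}=\bigcup_{a\in P_j}(a+N^{-(j+1)}P)$, and it is required that $P_j\subset A_j$ for all $j$. Put $E_j=\bigcup_{a\in A_j}(a+[0,N^{-j}])$, $F_j=\bigcup_{a\in P_j}(a+[0,N^{-j}))$,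 $f_\ell=\mathbf{1}_{F_\ell}$. Let $\mu_j$ be the absolutely continuous measure with density $\sum_{a\in A_j}t^{-j}N^j\mathbf{1}_{[a,a+N^{-j}]}$, and let $\mu$ be the weak limit of the $\mu_j$, a probability measure on $E=\bigcap_j E_j\subset[0,1]$. Fourier transforms are $\widehat{\nu}(\xi)=\int e^{-2\pi i x\xi}\,d\nu(x)$ and $\widehat{f\,d\nu}(\xi)=\int f(x)e^{-2\pi i x\xi}\,d\nu(x)$; $L^p(\mathbb{R})$ norms may equal $+\infty$. Fourier decay conditions: (D1) there is $C(\beta,n_0)$ with $|\widehat{\mu}(k)|\le C(\beta,n_0)|k|^{-\beta/2}$ for all $k\in\mathbb{Z}\setminus\{0\}$; (D2) for each $\ell\in\mathbb{N}$ there is $C(\beta,\ell,n_0)$ with $|\widehat{f_\ell\,d\mu_j}(k)|\le C(\beta,\ell,n_0)|k|^{-\beta/2}$ for all $k\in\mathbb{Z}\setminus\{0\}$ and all $j\ge\ell$. *)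

(* Defs.v *)
From HB Require Import structures.
From mathcomp Require Import all_boot all_order all_algebra finmap complex.
From mathcomp Require Import all_classical all_reals all_analysis.
From mathcomp Require Import measurable_realfun.

Set Implicit Arguments.
Unset Strict Implicit.
Unset Printing Implicit Defensive.

Import Order.TTheory GRing.Theory Num.Theory.
Import numFieldNormedType.Exports.

Local Open Scope classical_set_scope.
Local Open Scope ring_scope.

Definition arithmetic_progression (L : nat) (P : {fset nat}) : Prop :=
  exists b d : nat, (0 < d)%N /\ P = [fset (b + i * d)%N | i in iota 0 L]%fset.

(* N^{-j} [N], where [N] = {0, ..., N - 1}. *)
Definition scaled_digits (R : realType) (N j : nat) : {fset R} :=
  [fset (k%:R / N%:R ^+ j)%R | k in iota 0 N]%fset.

Fixpoint progression_set (R : realType) (N : nat) (P : {fset nat}) (j : nat)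
    : {fset R} :=
  if j is i.+1 then
    [fset (a + k%:R / N%:R ^+ i.+1)%R | a in progression_set R N P i, k in P]%fset
  else [fset 0%R]%fset.

Definition sys_param (m n0 : nat) : nat := (m ^ (2 * n0))%N.

(* With N = N0^{2 n0} and t = t0^{2 n0}, the fields are P = cs_prog (of length
   t^{1/2} = t0^{n0}), A_j = cs_A j, and A_{j+1,a} = cs_digits j.+1 a, which
   matters only for a in A_j: the values of cs_digits at index 0 or at a
   outside A_j are unconstrained. The set P_j is progression_set N P j. *)
Record cantor_system (R : realType) (N0 t0 n0 : nat) := CantorSystem {
  cs_prog : {fset nat};
  cs_digits : nat -> R -> {fset R};
  cs_A : nat -> {fset R};
  cs_prog_ap : arithmetic_progression (t0 ^ n0) cs_prog;
  cs_prog_lt : forall k, k \in cs_prog -> (k < sys_param N0 n0)%N;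
  cs_A0 : cs_A 0 = [fset 0%R]%fset;
  cs_AS : forall j,
    cs_A j.+1 = [fset (a + b)%R | a in cs_A j, b in cs_digits j.+1 a]%fset;
  cs_digits_sub : forall j a, a \in cs_A j ->
    (cs_digits j.+1 a `<=` scaled_digits R (sys_param N0 n0) j.+1)%fset;
  cs_digits_card : forall j a, a \in cs_A j ->
    #|` cs_digits j.+1 a|%fset = sys_param t0 n0;
  cs_prog_sub : forall j,
    (progression_set R (sys_param N0 n0) cs_prog j `<=` cs_A j)%fset
}.

Section cantor_objects.
Context {R : realType} {N0 t0 n0 : nat}.
Variable S : cantor_system R N0 t0 n0.

Local Notation N := (sys_param N0 n0).
Local Notation t := (sys_param t0 n0).

Definition cs_E (j : nat) : set R :=
  \bigcup_(a in [set` cs_A S j]) `[a, a + N%:R ^- j]%classic.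

Definition cs_limit_set : set R := \bigcap_j cs_E j.

Definition cs_F (j : nat) : set R :=
  \bigcup_(a in [set` progression_set R N (cs_prog S) j])
    `[a, a + N%:R ^- j[%classic.

Definition cs_f (l : nat) : R -> R := \1_(cs_F l).

Definition cs_density (j : nat) (x : R) : R :=
  \sum_(a <- cs_A S j) t%:R ^- j * N%:R ^+ j * \1_(`[a, a + N%:R ^- j]) x.

(* mu_j, the measure with density cs_density j. *)
Definition cs_approx (j : nat) (V : set (measurableTypeR R)) : \bar R :=
  (\int[lebesgue_measure]_(x in V) (cs_density j x)%:E)%E.

Lemma cs_density_ge0 j x : 0 <= cs_density j x.
Proof. by apply: sumr_ge0 => a _; rewrite !mulr_ge0// ?invr_ge0 ?exprn_ge0. Qed.

Lemma measurable_cs_density j :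
  measurable_fun [set: measurableTypeR R] (cs_density j).
Proof.
apply: measurable_sum => a; apply: measurable_funM; first exact: measurable_cst.
exact: measurable_indic.
Qed.

Let cs_approx0 j : cs_approx j set0 = 0%E.
Proof. by rewrite /cs_approx integral_set0. Qed.

Let cs_approx_ge0 j V : (0 <= cs_approx j V)%E.
Proof. by apply: integral_ge0 => x _; rewrite lee_fin cs_density_ge0. Qed.

Let cs_approx_sigma_additive j : semi_sigma_additive (cs_approx j).
Proof.
move=> F mF tF mUF; rewrite /cs_approx; apply: cvg_toP.
  apply: ereal_nondecreasing_is_cvgn => m n mn.
  apply: lee_sum_nneg_natr => // k _ _.
  by apply: integral_ge0 => x _; rewrite lee_fin cs_density_ge0.
rewrite ge0_integral_bigcup//=.
- apply: measurable_funTS; apply: measurableT_comp => //.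
  exact: measurable_cs_density.
- by move=> x _; rewrite lee_fin cs_density_ge0.
Qed.

HB.instance Definition _ j := isMeasure.Build _ _ _ (cs_approx j)
  (cs_approx0 j) (@cs_approx_ge0 j) (@cs_approx_sigma_additive j).

End cantor_objects.

Definition weak_limit (R : realType)
    (nu_ : nat -> {measure set (measurableTypeR R) -> \bar R})
    (nu : {measure set (measurableTypeR R) -> \bar R}) : Prop :=
  forall f : R -> R, continuous f -> (exists M : R, forall x, `|f x| <= M) ->
    (\int[nu_ j]_x f x) @[j --> \oo] --> \int[nu]_x f x.

Definition cantor_measure (R : realType) (N0 t0 n0 : nat)
    (S : cantor_system R N0 t0 n0)
    (mu : probability (measurableTypeR R) R) : Prop :=
  weak_limit (fun j => cs_approx S j) mu /\ mu (cs_limit_set S) = 1%E.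

(* The Fourier transform of f dnu, that is, the integral against nu of
   f(x) e^{- 2 pi i x xi}, for real-valued f; the complex-valued integral is
   taken componentwise. *)
Definition fourier_fun (R : realType)
    (nu : {measure set (measurableTypeR R) -> \bar R})
    (f : R -> R) (xi : R) : R[i] :=
  Complex (\int[nu]_x (f x * cos (- (2 * pi * x * xi))))
          (\int[nu]_x (f x * sin (- (2 * pi * x * xi)))).

Definition fourier (R : realType)
    (nu : {measure set (measurableTypeR R) -> \bar R}) (xi : R) : R[i] :=
  fourier_fun nu (cst 1) xi.

Definition fourier_decay (R : realType)
    (mu : {measure set (measurableTypeR R) -> \bar R}) (beta : R) : Prop :=
  exists C : R, forall k : int, k != 0 ->
    Normc.normc (fourier mu k%:~R) <= C * `|k%:~R| `^ (- (beta / 2)).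

Definition uniform_fourier_decay (R : realType) (N0 t0 n0 : nat)
    (S : cantor_system R N0 t0 n0) (beta : R) : Prop :=
  forall l : nat, exists C : R, forall (k : int) (j : nat),
    k != 0 -> (l <= j)%N ->
    Normc.normc (fourier_fun (cs_approx S j) (cs_f S l) k%:~R)
      <= C * `|k%:~R| `^ (- (beta / 2)).

(* No degenerate quotient arises from the convention (0)^-1 = +oo on \bar R:
   if the denominator is 0 then f_l dmu = 0, the numerator is 0 and so is the
   quotient. *)
Definition extension_ratio (R : realType) (N0 t0 n0 : nat)
    (S : cantor_system R N0 t0 n0)
    (mu : {measure set (measurableTypeR R) -> \bar R})
    (p q : R) (l : nat) : \bar R :=
  ('N[lebesgue_measure]_(p%:E)
      [EFin \o (fun xi => Normc.normc (fourier_fun mu (cs_f S l) xi))]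
   / 'N[mu]_(q%:E)[EFin \o cs_f S l])%E.

(* Main.v *)
(* The Cantor set is encoded by a t-adic tree whose digit sets are cyclic shifts
   of {0, ..., t - 1}; with T = t0 ^ n0 one has t = T ^ 2, and P = {0, ..., T - 1}.
   Decay: passing from mu_j to mu_{j+1} changes f_l dmu_j by a sum over the nodes
   of level j. The T ^ j nodes carrying P_j are not shifted and contribute
   O(t ^ -j T ^ j) = O(T ^ -j); for the other nodes the shifts average to zero,
   and a greedy (derandomized Hoeffding) choice makes the sum O((j + 1) T ^ -j)
   simultaneously for all frequencies mod N ^ (j+1). Since T = N ^ (alpha / 2),
   interpolating with the trivial decay N ^ (j+1) / |k| and summing over j gives
   |k| ^ (- beta / 2).
   Blow-up: at the frequencies k = \sum_(i < l) d_i N ^ i with |d_i| <= m, where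
   m ~ N / (16 T), the Fourier transforms of f_l dmu add up without cancellation,
   because N ^ i y is within T / N of an integer for y in F_l and i < l. With
   W = 2 m + 1 this gives
     ||(f_l dmu)^||_p ^ p >= c ^ l W ^ l mu(F_l) ^ p,   mu(F_l) >= T ^ -(l+1),
   and W beats T ^ (p (1 - 1/q)) for n0 large exactly when
   p < q (2 - alpha) / (alpha (q - 1)). *)
Require Import Defs.
From mathcomp Require Import all_boot all_order all_algebra finmap complex.
From mathcomp Require Import all_classical all_reals all_analysis.
From mathcomp Require Import measurable_realfun ring lra zify.

Import Order.TTheory GRing.Theory Num.Theory.
Import numFieldNormedType.Exports.

Local Open Scope classical_set_scope.
Local Open Scope ring_scope.

Set Implicit Arguments.
Unset Strict Implicit.

(** * Greedy choice of shifts *)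

(** The condition that [A_j] contains [P_j] forbids shifting the special nodes, so these can only be
    bounded trivially. This is affordable because the progression has length [t ^ (1/2)]: there are
    [T ^ j] special nodes, which is also the square-root size of a balanced sum over [t ^ j] nodes.
    A cyclic shift keeps exactly [t] distinct digits, and a uniformly chosen one is unbiased. The
    number of tests at level [j] is exponential in [j] but enters through its logarithm, whence the
    factor [j + 1]. Everything is done with real cosines of variable phase. The limit measure is the
    law of a coding map from base [t] expansions to points. The mass bound for [F_l] loses one level
    because [F_l] is made of half-open cells while a limit point may be the right end of its cell.
    In the blow-up, no lower bound holds at each single frequency, only for the sum over the chosen
    ones. A convexity estimate turns the sum into [p]-th powers, and a Lipschitz bound spreads each
    frequency to an interval of length about [2 ^ - l]. The losses are constants to the power [l],
    absorbed by a large [n0]. *)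

Lemma sum_le_exists_le (R : realType) (N : nat) (g : nat -> R) (c : R) :
  (0 < N)%N -> \sum_(x < N) g x <= N%:R * c ->
  exists2 x, (x < N)%N & g x <= c.
Proof.
move=> N0 gc; apply: contrapT => H.
suff : N%:R * c < \sum_(x < N) g x by rewrite ltNge gc.
rewrite mulr_natl -[N in _ *+ N]card_ord -sumr_const.
apply: ltr_sum => [|i _]; last first.
  by rewrite ltNge; apply/negP => gi; apply: H; exists i.
by apply/hasP; exists (Ordinal N0) => //; rewrite mem_index_enum.
Qed.

(** From [1 - y <= expR (- y)], because [(1 - y) (1 + y + 2 y ^ 2) = 1 + y ^ 2 (1 - 2 y)]. *)
Lemma expR_le_quadratic (R : realType) (y : R) :
  y <= 1 / 2 -> expR y <= 1 + y + 2 * y ^+ 2.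
Proof.
move=> y12; have := expR_ge1Dx (- y); rewrite expRN => h.
have e0 := expR_gt0 y.
have h1 : (1 - y) * expR y <= 1.
  by rewrite -ler_pdivlMr // div1r.
have y1 : 0 < 1 - y by lra.
rewrite -(ler_pM2l y1) (le_trans h1) //.
have : 0 <= y ^+ 2 * (1 - 2 * y) by rewrite mulr_ge0 ?sqr_ge0 //; lra.
lra.
Qed.

(* The potential \sum_tau expR (S_tau) can be kept from growing by more than a
   factor 1 + 2 B^2 at each step, since the linear terms average out. *)
Lemma greedy_balancing (R : realType) (Theta : finType) (N : nat) (B : R)
    (w : Theta -> nat -> nat -> R) :
  (0 < N)%N -> B <= 1 / 2 ->
  (forall tau i, \sum_(x < N) w tau i x = 0) ->
  (forall tau i x, `|w tau i x| <= B) ->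
  forall n, exists x : nat -> nat,
    forall tau, \sum_(i < n) w tau i (x i) <= ln #|Theta|%:R + n%:R * (2 * B ^+ 2).
Proof.
move=> N0 B12 w0 wB n.
suff [x Hx] : exists x : nat -> nat,
    \sum_(tau : Theta) expR (\sum_(i < n) w tau i (x i))
      <= #|Theta|%:R * (1 + 2 * B ^+ 2) ^+ n.
  exists x => tau.
  have e1 : expR (\sum_(i < n) w tau i (x i))
      <= #|Theta|%:R * (1 + 2 * B ^+ 2) ^+ n.
    apply: le_trans Hx; rewrite (bigD1 tau) //= lerDl.
    by apply: sumr_ge0 => ? _; exact: expR_ge0.
  have c0 : (0 < #|Theta|)%N by apply/card_gt0P; exists tau.
  rewrite -ler_expR (le_trans e1) // expRD lnK ?posrE ?ltr0n //.
  rewrite ler_pM2l ?ltr0n // mulr_natl expRM_natl lerXn2r ?nnegrE ?expR_ge0 //.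
    by have := sqr_ge0 B; lra.
  exact: expR_ge1Dx.
elim: n => [|n [x Hx]].
  exists (fun=> 0%N); rewrite expr0 mulr1.
  under eq_bigr do rewrite big_ord0 expR0.
  by rewrite sumr_const.
pose S tau := \sum_(i < n) w tau i (x i).
have [y yN Hy] : exists2 y, (y < N)%N &
    \sum_(tau : Theta) expR (S tau + w tau n y)
      <= #|Theta|%:R * (1 + 2 * B ^+ 2) ^+ n.+1.
  apply: sum_le_exists_le => //; rewrite exchange_big /=.
  apply: (@le_trans _ _
      (\sum_(tau : Theta) expR (S tau) * (N%:R * (1 + 2 * B ^+ 2)))).
    apply: ler_sum => tau _.
    under eq_bigr do rewrite expRD.
    rewrite -mulr_sumr ler_wpM2l ?expR_ge0 //.
    apply: (@le_trans _ _ (\sum_(y < N) (1 + 2 * B ^+ 2 + w tau n y))).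
      apply: ler_sum => y _; have wb := wB tau n y.
      apply: le_trans (expR_le_quadratic _) _.
        by rewrite (le_trans _ B12) // (le_trans _ wb) // ler_norm.
      have : w tau n y ^+ 2 <= B ^+ 2.
        by rewrite -real_normK ?num_real // lerXn2r ?nnegrE // (le_trans _ wb).
      by lra.
    by rewrite big_split /= w0 addr0 sumr_const card_ord -[_ *+ N]mulr_natl.
  rewrite -mulr_suml (exprS _ n).
  have : (0 : R) <= N%:R * (1 + 2 * B ^+ 2).
    by apply: mulr_ge0 => //; have := sqr_ge0 B; lra.
  move=> /ler_wpM2r => /(_ _ _ Hx) /le_trans; apply.
  by rewrite le_eqVlt; apply/orP; left; apply/eqP => /=; ring.
exists (fun i => if (i < n)%N then x i else y).
apply: le_trans Hy; apply: ler_sum => tau _.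
rewrite big_ord_recr /= ltnn ler_expR lerD2r.
by apply: ler_sum => i _; rewrite ltn_ord.
Qed.

(** * The digit tree and its exponential sums *)

Lemma sum_cyclic_shift (R : nmodType) (N r : nat) (G : nat -> R) :
  \sum_(x < N) G ((r + x) %% N)%N = \sum_(m < N) G m.
Proof.
case: N => [|N]; first by rewrite !big_ord0.
pose h (x : 'I_N.+1) : 'I_N.+1 := inord ((r + x) %% N.+1).
have hi : injective h.
  move=> x y /(congr1 val); rewrite /= !inordK ?ltn_pmod // => /eqP.
  rewrite eqn_modDl !modn_small // => /eqP xy; exact/val_inj.
rewrite [RHS](reindex_inj hi) /=.
by apply: eq_bigr => x _; rewrite inordK // ltn_pmod.
Qed.

(* The tree of digits: the children of node n at level j are the nodes
   t * n + r, r < t, at level j + 1, and node n at level j carries the point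
   addr x j n / N ^ j of A_j. The r-th child digit is r shifted cyclically by
   x j n; special nodes, those all of whose digits are < T, carry P_j. *)
Fixpoint special (t T j n : nat) : bool :=
  if j is i.+1 then special t T i (n %/ t)%N && (n %% t < T)%N else true.

Fixpoint addr (N t : nat) (x : nat -> nat -> nat) (j n : nat) : nat :=
  if j is i.+1
  then (N * addr N t x i (n %/ t) + (n %% t + x i (n %/ t)%N) %% N)%N else 0%N.

(** The character [exp (2 pi i n / M)] in real form: the phases 0 and [pi / 2] give its real part
    and minus its imaginary part. *)
Definition wave (R : realType) (M n : nat) (phi : R) : R :=
  cos (2 * pi * (n%:R / M%:R) + phi).

(** The contribution of a node with address [e] to the passage from one level to the next: the [t]
    children kept under the shift [x], minus the proportion [t / N] of all [N] subcells, which
    together make up the cell of the node. *)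
Definition child_defect (R : realType) (N t M k e x : nat) (phi : R) : R :=
  \sum_(r < t) wave M (k * (N * e + (r + x) %% N)) phi
  - t%:R / N%:R * \sum_(m < N) wave M (k * (N * e + m)) phi.

Section wave.
Variable R : realType.
Implicit Types phi : R.

Lemma cosD2pin (n : nat) (x : R) : cos (x + 2 * pi * n%:R) = cos x.
Proof.
rewrite (_ : 2 * pi * n%:R = (pi *+ 2) *+ n) ?(periodicn (@cosD2pi R)) //.
by rewrite -[in RHS]mulr_natr -[pi *+ 2]mulr_natl.
Qed.

Lemma wave_mod (M n : nat) phi : (0 < M)%N -> wave M (n %% M) phi = wave M n phi.
Proof.
move=> M0; rewrite /wave [in RHS](divn_eq n M) natrD natrM [(_ + _) / _]mulrDl mulfK; last first.
  by rewrite pnatr_eq0 -lt0n.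
by rewrite addrC -(cosD2pin (n %/ M)); congr cos; ring.
Qed.

Lemma wave_modMl (M k n : nat) phi : (0 < M)%N ->
  wave M ((k %% M) * n) phi = wave M (k * n) phi.
Proof. by move=> M0; rewrite -wave_mod // modnMml wave_mod. Qed.

Lemma normr_wave_le1 (M n : nat) phi : `|wave M n phi| <= 1.
Proof. by rewrite ler_norml cos_geN1 cos_le1. Qed.

(** Only [k] modulo [M] matters, so finitely many tests cover all frequencies. *)
Lemma child_defect_mod (N t M k e x : nat) phi : (0 < M)%N ->
  child_defect N t M (k %% M) e x phi = child_defect N t M k e x phi.
Proof.
move=> M0; rewrite /child_defect.
by under eq_bigr do rewrite wave_modMl //; under [in X in _ - X]eq_bigr do rewrite wave_modMl //.
Qed.

(** As [x] runs through all shifts, each digit [r] visits every residue once: this is the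
    unbiasedness that the greedy choice needs. *)
Lemma sum_child_defect (N t M k e : nat) phi : (0 < N)%N ->
  \sum_(x < N) child_defect N t M k e x phi = 0.
Proof.
move=> N0; rewrite big_split /= exchange_big /=.
under eq_bigr => r _ do
  rewrite (sum_cyclic_shift N r (fun m => wave M (k * (N * e + m)) phi)).
rewrite !sumr_const !card_ord -[_ *+ t]mulr_natl -[_ *+ N]mulr_natl.
have : N%:R != 0 :> R by rewrite pnatr_eq0 -lt0n.
by move=> ?; field.
Qed.

Lemma normr_child_defect_le (N t M k e x : nat) phi :
  `|child_defect N t M k e x phi| <= 2 * t%:R.
Proof.
have sumw n (F : nat -> nat) : `|\sum_(i < n) wave M (F i) phi| <= n%:R.
  rewrite (le_trans (ler_norm_sum _ _ _)) //.
  rewrite -[leRHS]mulr_natl mulr1 -[n in leRHS]card_ord -sumr_const.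
  by apply: ler_sum => i _; exact: normr_wave_le1.
rewrite /child_defect (le_trans (ler_normB _ _)) //.
have := sumw t (fun r => k * (N * e + (r + x) %% N))%N.
have := sumw N (fun m => k * (N * e + m))%N.
move=> h1 h2; rewrite [leRHS]mulr_natl mulr2n lerD //.
case: N h1 {h2} => [|N] h1; first by rewrite big_ord0 mulr0 normr0.
rewrite normrM ger0_norm ?divr_ge0 //.
apply: le_trans (ler_wpM2l _ h1) _; rewrite ?divr_ge0 //.
by rewrite divfK // pnatr_eq0.
Qed.

End wave.

(** Greedy balancing over the nodes of one level, for arbitrary addresses [e]. Every depth [l <= j]
    is tested at once, so that the same shifts serve all the functions [f_l]. *)
Lemma balanced_shifts (R : realType) (N t T j : nat) (e : nat -> nat) :
  (0 < N)%N -> (0 < T)%N -> t = (T ^ 2)%N ->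
  exists x : nat -> nat, (forall n, special t T j n -> x n = 0%N) /\
  forall (l k : nat) (phi : R), (l <= j)%N -> phi = 0 \/ phi = pi / 2 ->
  `|\sum_(i < t ^ j | special t T l (i %/ t ^ (j - l)) && ~~ special t T j i)
      child_defect N t (N ^ j.+1) k (e i) (x i) phi|
    <= 4 * t%:R * T%:R ^+ j * (ln (4 * j.+1 * N ^ j.+1)%:R + 1 / 2).
Proof.
move=> N0 T0 tE.
have Tr : (0 : R) < T%:R by rewrite ltr0n.
have t0 : (0 : R) < t%:R by rewrite ltr0n tE expn_gt0 T0.
have M0 : (0 < N ^ j.+1)%N by rewrite expn_gt0 N0.
(* A test is a depth, a residue of [k], one of two phases and a sign; the sign turns one-sided
   bounds into bounds for absolute values. *)
pose Theta : finType := ('I_j.+1 * 'I_(N ^ j.+1) * (bool * bool))%type.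
pose ph (b : bool) : R := if b then 0 else pi / 2.
(* With this normalisation the weights are at most [1 / (2 T ^ j) <= 1 / 2], as the greedy lemma
   requires, and the quadratic terms of all [t ^ j = T ^ (2 j)] steps add up to [1 / 2]. *)
pose c : R := 4 * t%:R * T%:R ^+ j.
have c0 : 0 < c by rewrite !mulr_gt0 // exprn_gt0.
pose sel (l i : nat) := special t T l (i %/ t ^ (j - l)) && ~~ special t T j i.
pose w (tau : Theta) (i x : nat) : R :=
  (sel tau.1.1 i)%:R * (-1) ^+ tau.2.2 *
    child_defect N t (N ^ j.+1) tau.1.2 (e i) x (ph tau.2.1) / c.
have Bh : ((2 * T%:R ^+ j)^-1 : R) <= 1 / 2.
  rewrite div1r lef_pV2 ?posrE ?mulr_gt0 ?exprn_gt0 // ler_peMr //.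
  by rewrite exprn_ege1 // ler1n.
have w0 tau i : \sum_(x < N) w tau i x = 0.
  by rewrite -mulr_suml -mulr_sumr sum_child_defect // mulr0 mul0r.
have wB tau i x : `|w tau i x| <= (2 * T%:R ^+ j)^-1.
  rewrite /w !normrM normrX normrN1 expr1n mulr1 normfV.
  rewrite (gtr0_norm c0) ler_pdivrMr //.
  have -> : (2 * T%:R ^+ j)^-1 * c = 2 * t%:R.
    have : T%:R ^+ j != 0 :> R by rewrite expf_neq0 // gt_eqF.
    by move=> ?; rewrite /c; field.
  rewrite -[leRHS]mul1r ler_pM ?normr_ge0 // ?normr_child_defect_le //.
  by case: (sel _ _); rewrite ?normr1 ?normr0.
have [x Hx] := greedy_balancing N0 Bh w0 wB (t ^ j).
have cardTheta : #|Theta| = (4 * j.+1 * N ^ j.+1)%N.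
  by rewrite !card_prod !card_bool !card_ord; lia.
have half : (t ^ j)%:R * (2 * ((2 * T%:R ^+ j)^-1) ^+ 2) = 1 / 2 :> R.
  rewrite tE -expnM mulnC expnM natrX natrX.
  have : T%:R ^+ j != 0 :> R by rewrite expf_neq0 // gt_eqF.
  by move=> ?; field.
(* Special nodes have weight 0 in every test, so resetting their shifts to 0 changes no sum. *)
exists (fun i => if special t T j i then 0%N else x i); split=> [n ->//|].
move=> l k phi lj phiP.
have [b {phiP}->] : exists b, phi = ph b.
  by case: phiP => ->; [exists true|exists false].
have kM : (k %% N ^ j.+1 < N ^ j.+1)%N by rewrite ltn_pmod.
have lj' : (l < j.+1)%N by [].
pose tau (s : bool) : Theta := ((Ordinal lj', Ordinal kM), (b, s)).
have main (s : bool) : (-1) ^+ s * \sum_(i < t ^ j | sel l i)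
      child_defect N t (N ^ j.+1) k (e i) (x i) (ph b)
    <= c * (ln (4 * j.+1 * N ^ j.+1)%:R + 1 / 2).
  rewrite -ler_pdivrMl //.
  have := Hx (tau s); rewrite cardTheta half => /(le_trans _); apply.
  rewrite le_eqVlt; apply/orP; left; apply/eqP.
  rewrite !mulr_sumr [LHS]big_mkcond /=; apply: eq_bigr => i _.
  rewrite /w /= child_defect_mod //; case: (sel l i); rewrite /= ?mul0r //.
  by rewrite mul1r mulrC.
rewrite (eq_bigr (fun i : 'I__ => child_defect N t (N ^ j.+1) k (e i) (x i) (ph b))); last first.
  by move=> i /andP[_ /negbTE ->].
rewrite ler_norml; have := main true; have := main false.
rewrite expr0 expr1 mul1r mulN1r -/c /sel => -> ?; rewrite andbT.
by rewrite lerNl.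
Qed.

(* The shifts of a level can be chosen knowing only the addresses of that level,
   hence by recursion. *)
Lemma balanced_addresses (R : realType) (N t T : nat) :
  (0 < N)%N -> (0 < T)%N -> t = (T ^ 2)%N ->
  exists x : nat -> nat -> nat,
  (forall j n, special t T j n -> x j n = 0%N) /\
  forall (j l k : nat) (phi : R), (l <= j)%N -> phi = 0 \/ phi = pi / 2 ->
  `|\sum_(i < t ^ j | special t T l (i %/ t ^ (j - l)) && ~~ special t T j i)
      child_defect N t (N ^ j.+1) k (addr N t x j i) (x j i) phi|
    <= 4 * t%:R * T%:R ^+ j * (ln (4 * j.+1 * N ^ j.+1)%:R + 1 / 2).
Proof.
move=> N0 T0 tE.
have /choice[X HX] := fun je : nat * (nat -> nat) =>
  @balanced_shifts R N t T je.1 je.2 N0 T0 tE.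
pose fix E (j : nat) : nat -> nat := if j is i.+1
  then (fun n => N * E i (n %/ t) + (n %% t + X (i, E i) (n %/ t)%N) %% N)%N
  else fun=> 0%N.
have addrE j : addr N t (fun j => X (j, E j)) j = E j.
  by elim: j => //= j IH; apply/funext => n; rewrite IH.
exists (fun j => X (j, E j)); split=> [j|j l k phi]; first exact: (HX (j, E j)).1.
by rewrite addrE; exact: (HX (j, E j)).2.
Qed.

(** * Fourier coefficients of the approximating measures *)

Section trigonometric_bounds.
Variable R : realType.
Implicit Types x y phi : R.

Lemma sin_lipschitz x y : `|sin x - sin y| <= `|x - y|.
Proof.
wlog yx : x y / y <= x.
  by move=> H; case/orP: (le_total y x) => /H //; rewrite distrC (distrC x).
have cs : {within `[y, x], continuous (@sin R)}.
  by apply: continuous_subspaceT; exact: continuous_sin.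
have [c _ ->] := MVT_segment yx (fun z _ => is_derive_sin z) cs.
by rewrite normrM ler_piMl // cos_max.
Qed.

Lemma cos_lipschitz x y : `|cos x - cos y| <= `|x - y|.
Proof.
rewrite -!sinDpihalf (le_trans (sin_lipschitz _ _)) //.
by rewrite (_ : x + _ - _ = x - y) //; ring.
Qed.

Lemma cos_ge_half x : `|x| <= 1 / 2 -> 1 / 2 <= cos x.
Proof.
move=> x2; have := cos_lipschitz x 0; rewrite cos0 subr0 ler_norml => /andP[+ _].
lra.
Qed.

Lemma pi_lt4 : (pi : R) < 4.
Proof. by have := @pihalf_lt2 R; lra. Qed.

End trigonometric_bounds.

Lemma big_ord_mul_nested (V : nmodType) (m n : nat) (F : nat -> V) :
  \sum_(i < m * n) F i = \sum_(i < m) \sum_(r < n) F (i * n + r)%N.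
Proof.
elim: m => [|m IH]; first by rewrite mul0n !big_ord0.
by rewrite mulSnr big_split_ord big_ord_recr /= IH.
Qed.

Lemma big_children (V : nmodType) (t j : nat) (P : nat -> bool) (F : nat -> V) :
  (0 < t)%N ->
  \sum_(i < t ^ j.+1 | P (i %/ t)%N) F i
    = \sum_(i < t ^ j | P i) \sum_(r < t) F (i * t + r)%N.
Proof.
move=> t0; rewrite big_mkcond expnSr /=.
rewrite (big_ord_mul_nested _ _ (fun i => if P (i %/ t)%N then F i else 0)).
rewrite [RHS]big_mkcond /=; apply: eq_bigr => i _.
under eq_bigr => r _ do rewrite divnMDl // divn_small // addn0.
by case: (P i) => //; rewrite big1.
Qed.

Lemma sum_special (R : nzSemiRingType) (t T j : nat) : (0 < t)%N -> (T <= t)%N ->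
  \sum_(i < t ^ j | special t T j i) 1 = (T ^ j)%:R :> R.
Proof.
move=> t0 Tt; elim: j => [|j IH]; first by rewrite expn0 big_ord_recl big_ord0 /= addr0.
rewrite /= big_mkcondr.
rewrite (big_children j (special t T j) (fun i => if (i %% t < T)%N then 1 else 0)) //.
under eq_bigr => i _.
  under eq_bigr => r _ do rewrite modnMDl modn_small //.
  rewrite -big_mkcond /= (big_ord_narrow Tt) sumr_const card_ord.
  over.
by rewrite -[T%:R]mul1r -mulr_suml IH -natrM expnSr.
Qed.

(** Sums the increments over all levels; the factor [j.+1] is the logarithm of the number of tests.
    The proof multiplies out to an exact closed form. *)
Lemma sum_arith_geom_le (R : realFieldType) (theta : R) (n : nat) :
  0 <= theta < 1 ->
  \sum_(j < n) j.+1%:R * theta ^+ j <= ((1 - theta) ^+ 2)^-1.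
Proof.
move=> /andP[th0 th1].
have d0 : 0 < (1 - theta) ^+ 2 by rewrite exprn_gt0 // subr_gt0.
rewrite -[leRHS]mul1r ler_pdivlMr //.
have -> : (\sum_(j < n) j.+1%:R * theta ^+ j) * (1 - theta) ^+ 2
    = 1 - theta ^+ n - n%:R * theta ^+ n * (1 - theta).
  elim: n => [|n IH]; first by rewrite big_ord0 expr0; ring.
  by rewrite big_ord_recr /= mulrDl IH [theta ^+ n.+1]exprS -natr1; ring.
have := exprn_ge0 n th0.
have : 0 <= n%:R * theta ^+ n * (1 - theta).
  by rewrite !mulr_ge0 ?exprn_ge0 // subr_ge0 ltW.
lra.
Qed.

(* The integral of cos (2 pi k x + phi) over [a, a + delta]. *)
Definition arc (R : realType) (a delta : R) (k : nat) (phi : R) : R :=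
  (sin (2 * pi * k%:R * (a + delta) + phi) - sin (2 * pi * k%:R * a + phi))
    / (2 * pi * k%:R).

(** The closed form of the integral of [f_l] times [cos (2 pi k y + phi)] against [mu_j], for
    [l <= j] and [k > 0]: up to right endpoints, [f_l] is 1 on the cells whose ancestor at level [l]
    is special and 0 on the others. *)
Definition coefficient (R : realType) (N t T : nat) (x : nat -> nat -> nat)
    (j l k : nat) (phi : R) : R :=
  \sum_(i < t ^ j | special t T l (i %/ t ^ (j - l)))
    t%:R ^- j * N%:R ^+ j *
      arc ((addr N t x j i)%:R / N%:R ^+ j) (N%:R ^- j) k phi.

Section arc.
Variable R : realType.
Implicit Types phi a : R.

Lemma normr_arc_le a (delta : R) (k : nat) phi : (0 < k)%N ->
  `|arc a delta k phi| <= k%:R^-1.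
Proof.
move=> k0; have kr : (0 : R) < k%:R by rewrite ltr0n.
have p2 := @pi_ge2 R.
have d0 : 0 < 2 * pi * k%:R :> R by rewrite !mulr_gt0 //; lra.
rewrite /arc normrM normfV (gtr0_norm d0).
rewrite invfM mulrA ler_piMl ?invr_ge0 ?ler0n //.
rewrite ler_pdivrMr ?mul1r; last by lra.
rewrite (le_trans (ler_normB _ _)) // (le_trans (lerD (sin_max _) (sin_max _))) //.
lra.
Qed.

Lemma wave_phase (M n : nat) phi :
  wave M n phi = cos phi * wave M n 0 + sin phi * wave M n (pi / 2).
Proof. by rewrite /wave addr0 cosDpihalf cosD; ring. Qed.

(** Extends the two tested phases to all phases, which is needed because integrating over a cell
    moves the phase to the midpoint of the cell. *)
Lemma child_defect_phase (N t M k e x : nat) phi :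
  child_defect N t M k e x phi =
  cos phi * child_defect N t M k e x 0 + sin phi * child_defect N t M k e x (pi / 2).
Proof.
have lin n (F : nat -> nat) : \sum_(i < n) wave M (F i) phi =
    cos phi * \sum_(i < n) wave M (F i) 0
    + sin phi * \sum_(i < n) wave M (F i) (pi / 2).
  rewrite !mulr_sumr -big_split /=; apply: eq_bigr => i _; exact: wave_phase.
rewrite /child_defect (lin t (fun r => k * (N * e + (r + x) %% N))%N).
by rewrite (lin N (fun m => k * (N * e + m))%N); ring.
Qed.

(** The Fourier transform at [k] of the indicator of an interval of length [1 / M] centred at 0. *)
Definition arc_gain (M k : nat) : R := sin (pi * k%:R / M%:R) / (pi * k%:R).

Lemma arc_wave (M m k : nat) phi : (0 < M)%N -> (0 < k)%N ->
  arc (m%:R / M%:R) (M%:R^-1) k phi =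
  arc_gain M k * wave M (k * m) (phi + pi * k%:R / M%:R).
Proof.
move=> M0 k0; have kr : (k%:R : R) != 0 by rewrite pnatr_eq0 -lt0n.
have Mr : (M%:R : R) != 0 by rewrite pnatr_eq0 -lt0n.
have pr : (pi : R) != 0 by rewrite gt_eqF // pi_gt0.
rewrite /arc /arc_gain /wave; set h := pi * k%:R / M%:R.
have -> : 2 * pi * ((k * m)%:R / M%:R) + (phi + h) = (2 * pi * k%:R * (m%:R / M%:R) + phi) + h.
  by rewrite natrM; ring.
have -> : 2 * pi * k%:R * (m%:R / M%:R + M%:R^-1) + phi =
    (2 * pi * k%:R * (m%:R / M%:R) + phi + h) + h by rewrite /h; field.
set A := 2 * _ * _ * _ + _.
have -> : sin A = sin ((A + h) - h) by congr sin; ring.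
move: (A + h) => {}A; rewrite (sinD A) (sinB A); clearbody h.
by move: (pi : R) pr => p pr; field; rewrite kr.
Qed.

(** The left side is at most 1, by [|sin z| <= |z|], and at most [M / k], by [|sin z| <= 1]; the
    smaller of 1 and a positive [r] is at most [r ^ b]. *)
Lemma normr_arc_gain_le (M k : nat) (b : R) : (0 < M)%N -> (0 < k)%N ->
  0 <= b <= 1 -> M%:R * `|arc_gain M k| <= (M%:R / k%:R) `^ b.
Proof.
move=> M0 k0 /andP[b0 b1]; have kr : (0 : R) < k%:R by rewrite ltr0n.
have Mr : (0 : R) < M%:R by rewrite ltr0n.
have p2 := @pi_ge2 R.
have g1 : M%:R * `|arc_gain M k| <= 1.
  rewrite -ler_pdivlMl // mulr1 /arc_gain normrM normfV ler_pdivrMr; last first.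
    by rewrite normr_gt0 mulf_neq0 // gt_eqF //; lra.
  have := sin_lipschitz (pi * k%:R / M%:R : R) 0; rewrite sin0 !subr0.
  move=> /le_trans; apply.
  by rewrite normrM mulrC normfV (gtr0_norm Mr).
have g2 : M%:R * `|arc_gain M k| <= M%:R / k%:R.
  have d0 : 0 < pi * k%:R :> R by rewrite mulr_gt0 //; lra.
  rewrite ler_pM2l // /arc_gain normrM normfV (gtr0_norm d0).
  rewrite invfM mulrA ler_piMl ?invr_ge0 // ?ler0n //.
  rewrite ler_pdivrMr ?mul1r; last by lra.
  by rewrite (le_trans (sin_max _)) //; lra.
have q0 : 0 < M%:R / k%:R :> R by rewrite divr_gt0.
have [q1|q1] := leP (M%:R / k%:R : R) 1.
  by rewrite (le_trans g2) // ger1_powR // q0 q1.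
by rewrite (le_trans g1) // -[leLHS](powRr0 (M%:R / k%:R)) ler_powR // ltW.
Qed.

Lemma arc_split (N j e k : nat) phi : (0 < N)%N ->
  arc (e%:R / N%:R ^+ j) (N%:R ^- j) k phi =
  \sum_(m < N) arc ((N * e + m)%:R / N%:R ^+ j.+1) (N%:R ^- j.+1) k phi.
Proof.
move=> N0; have Nr : (N%:R : R) != 0 by rewrite pnatr_eq0 -lt0n.
have Nj : (N%:R ^+ j : R) != 0 by rewrite expf_neq0.
pose f m : R := sin (2 * pi * k%:R * ((N * e + m)%:R / N%:R ^+ j.+1) + phi).
rewrite /arc -mulr_suml; congr (_ / _).
transitivity (f N - f 0%N); first (rewrite /f; congr (sin (_ * _ + _) - sin (_ * _ + _))).
- by rewrite exprS natrD natrM; field; rewrite ?Nr ?Nj.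
- by rewrite exprS addn0 natrM; field; rewrite ?Nr ?Nj.
rewrite -(telescope_sumr f (leq0n N)) big_mkord.
apply: eq_bigr => m _; rewrite /f; congr (sin (_ * _ + _) - _).
by rewrite addnS -natr1 exprS; field; rewrite ?Nr ?Nj.
Qed.

End arc.

(** Cutting each cell of level [j] into its [N] subcells puts both coefficients on intervals of the
    common length [N ^ - (j + 1)]. The gain then factors out and the defects of the nodes remain. *)
Lemma coefficient_increment (R : realType) (N t T : nat) (x : nat -> nat -> nat)
    (j l k : nat) (phi : R) :
  (0 < N)%N -> (0 < t)%N -> (0 < k)%N -> (l <= j)%N ->
  coefficient N t T x j.+1 l k phi - coefficient N t T x j l k phi =
  t%:R ^- j.+1 * N%:R ^+ j.+1 * arc_gain R (N ^ j.+1) k *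
  \sum_(i < t ^ j | special t T l (i %/ t ^ (j - l)))
    child_defect N t (N ^ j.+1) k (addr N t x j i) (x j i)
      (phi + pi * k%:R / (N ^ j.+1)%:R).
Proof.
move=> N0 t0 k0 lj.
have M0 : (0 < N ^ j.+1)%N by rewrite expn_gt0 N0.
have Nr : (N%:R : R) != 0 by rewrite pnatr_eq0 -lt0n.
have tr : (t%:R : R) != 0 by rewrite pnatr_eq0 -lt0n.
have Nj : (N%:R ^+ j : R) != 0 by rewrite expf_neq0.
have tj : (t%:R ^+ j : R) != 0 by rewrite expf_neq0.
rewrite /coefficient.
rewrite [X in X - _](eq_bigl (fun i : 'I_(t ^ j.+1) =>
    special t T l (i %/ t %/ t ^ (j - l)))); last first.
  by move=> i; rewrite subSn // (expnS t (j - l)) divnMA.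
rewrite (big_children j (fun n => special t T l (n %/ t ^ (j - l)))
  (fun n => t%:R ^- j.+1 * N%:R ^+ j.+1 *
      arc ((addr N t x j.+1 n)%:R / N%:R ^+ j.+1) (N%:R ^- j.+1) k phi)) //.
rewrite -sumrB mulr_sumr; apply: eq_bigr => i _.
under eq_bigr => r _.
  rewrite /= divnMDl // divn_small // addn0 modnMDl (modn_small (ltn_ord r)) -[N%:R ^+ j.+1]natrX arc_wave //.
  over.
rewrite arc_split // -[N%:R ^+ j.+1]natrX.
under [X in _ - _ * X]eq_bigr => m _ do rewrite arc_wave //.
rewrite -!mulr_sumr /child_defect natrX.
set ga := arc_gain _ _ _; set S1 := \sum_(_ < _) _; set S2 := \sum_(_ < _) _.
by rewrite !exprS; field; rewrite ?Nr ?tr ?tj ?Nj.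
Qed.

(** Since [4 (j + 1) <= 8 ^ (j + 1)], the logarithm of the number of tests grows at most linearly in
    [j]. *)
Lemma ln_test_count_le (R : realType) (N j : nat) : (0 < N)%N ->
  ln (4 * j.+1 * N ^ j.+1)%:R <= j.+1%:R * ln (8 * N)%:R :> R.
Proof.
move=> N0; rewrite mulr_natl -lnXn ?ltr0n ?muln_gt0 //.
rewrite ler_ln ?posrE ?exprn_gt0 ?ltr0n ?muln_gt0 ?expn_gt0 ?N0 //.
rewrite -natrX ler_nat expnMn leq_mul2r; apply/orP; right.
rewrite [leqRHS](_ : _ = 4 ^ j.+1 * 2 ^ j.+1)%N; last by rewrite -expnMn.
apply: leq_mul; last exact/ltnW/ltn_expl.
by rewrite -[leqLHS]expn1 leq_exp2l.
Qed.

Section coefficient_decay.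
Variables (R : realType) (N t T : nat) (x : nat -> nat -> nat).
Hypotheses (N0 : (0 < N)%N) (T0 : (0 < T)%N) (tE : t = (T ^ 2)%N).
Hypothesis x_balanced : forall (j l k : nat) (phi : R),
  (l <= j)%N -> phi = 0 \/ phi = pi / 2 ->
  `|\sum_(i < t ^ j | special t T l (i %/ t ^ (j - l)) && ~~ special t T j i)
      child_defect N t (N ^ j.+1) k (addr N t x j i) (x j i) phi|
    <= 4 * t%:R * T%:R ^+ j * (ln (4 * j.+1 * N ^ j.+1)%:R + 1 / 2).

Let t0 : (0 < t)%N. Proof. by rewrite tE expn_gt0 T0. Qed.
Let Tt : (T <= t)%N. Proof. by rewrite tE -[leqLHS]expn1 leq_pexp2l. Qed.

(** The special nodes cost [2 t] each; the others cost the balanced bound twice, once for each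
    tested phase. The constant 6 is [2 + 8 / 2]. *)
Lemma normr_sum_child_defect_le (j l k : nat) (phi : R) : (l <= j)%N ->
  `|\sum_(i < t ^ j | special t T l (i %/ t ^ (j - l)))
      child_defect N t (N ^ j.+1) k (addr N t x j i) (x j i) phi|
    <= t%:R * T%:R ^+ j * (j.+1%:R * (8 * ln (8 * N)%:R + 6)).
Proof.
move=> lj; pose cd i := child_defect N t (N ^ j.+1) k (addr N t x j i) (x j i) phi.
pose sl (i : nat) := special t T l (i %/ t ^ (j - l)).
rewrite -/sl (bigID (fun i : 'I_(t ^ j) => special t T j i)) /=.
rewrite (le_trans (ler_normD _ _)) //.
have spec : `|\sum_(i < t ^ j | sl i && special t T j i) cd i|
    <= 2 * t%:R * T%:R ^+ j.
  rewrite (le_trans (ler_norm_sum _ _ _)) //.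
  rewrite (le_trans (_ : _ <= \sum_(i < t ^ j | special t T j i) 2 * t%:R)) //.
    rewrite [leLHS]big_mkcond [leRHS]big_mkcond /=; apply: ler_sum => i _.
    case: (sl i) => //=; case: (special _ _ _ _) => //.
    exact: normr_child_defect_le.
  under eq_bigr do rewrite -[2 * _]mulr1.
  by rewrite -mulr_sumr sum_special // natrX.
have nspec : `|\sum_(i < t ^ j | sl i && ~~ special t T j i) cd i|
    <= 8 * t%:R * T%:R ^+ j * (j.+1%:R * ln (8 * N)%:R + 1 / 2).
  under eq_bigr => i _ do rewrite /cd child_defect_phase.
  rewrite big_split /= -!mulr_sumr (le_trans (ler_normD _ _)) // !normrM.
  have := x_balanced k lj (or_introl erefl).
  have := x_balanced k lj (or_intror erefl).
  rewrite -/sl => h1 h2.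
  have lnN := @ln_test_count_le R N j N0.
  have g2 := le_trans (ler_piMl (normr_ge0 _) (cos_max phi)) h2.
  have g1 := le_trans (ler_piMl (normr_ge0 _) (sin_max phi)) h1.
  rewrite (le_trans (lerD g2 g1)) //.
  have tT : 0 <= t%:R * T%:R ^+ j :> R by rewrite mulr_ge0 // exprn_ge0.
  by have := ler_wpM2l tT lnN; lra.
rewrite (le_trans (lerD spec nspec)) //.
have tT : 0 <= t%:R * T%:R ^+ j :> R by rewrite mulr_ge0 // exprn_ge0.
have : t%:R * T%:R ^+ j * 1 <= t%:R * T%:R ^+ j * j.+1%:R :> R.
  by rewrite ler_wpM2l // ler1n.
lra.
Qed.

(** The gain supplies [(N ^ (j + 1) / k) ^ b], and the weight [t ^ - (j + 1)] reduces [t T ^ j] to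
    [T ^ - j], so the increments are dominated by a series of ratio [N ^ b / T]. *)
Lemma coefficient_increment_le (j l k : nat) (phi b : R) :
  (l <= j)%N -> (0 < k)%N -> 0 <= b <= 1 ->
  `|coefficient N t T x j.+1 l k phi - coefficient N t T x j l k phi|
    <= (8 * ln (8 * N)%:R + 6) * N%:R `^ b * k%:R `^ (- b)
       * (j.+1%:R * (N%:R `^ b / T%:R) ^+ j).
Proof.
move=> lj k0 b01; rewrite coefficient_increment // 3!normrM.
have Nr : (0 : R) < N%:R by rewrite ltr0n.
have tr : (0 : R) < t%:R by rewrite ltr0n.
have Tr : (0 : R) < T%:R by rewrite ltr0n.
have kr : (0 : R) < k%:R by rewrite ltr0n.
have M0 : (0 < N ^ j.+1)%N by rewrite expn_gt0 N0.
have h1 := normr_sum_child_defect_le k (phi + pi * k%:R / (N ^ j.+1)%:R) lj.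
have h2 := normr_arc_gain_le M0 k0 b01.
have tj0 : 0 <= t%:R ^- j.+1 :> R by rewrite invr_ge0 exprn_ge0.
rewrite (ger0_norm tj0) (ger0_norm (exprn_ge0 _ (ltW Nr))) -[N%:R ^+ j.+1]natrX.
set ga := `|arc_gain _ _ _|; set S := `|\sum_(_ < _ | _) _|.
rewrite (_ : _ * ga * S = t%:R ^- j.+1 * ((N ^ j.+1)%:R * ga * S)); last by ring.
have ga0 : 0 <= (N ^ j.+1)%:R * ga by rewrite mulr_ge0 ?ler0n ?normr_ge0.
apply: le_trans (ler_wpM2l tj0 (ler_pM ga0 (normr_ge0 _) h2 h1)) _.
rewrite natrX powRM ?exprn_ge0 ?invr_ge0 //.
rewrite -[N%:R ^+ j.+1]powR_mulrn // powRAC powR_mulrn ?powR_ge0 //.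
rewrite [k%:R^-1 `^ b](_ : _ = k%:R `^ (- b)); last first.
  by rewrite -powR_inv1 // -powRrM mulN1r.
have eT : t%:R ^- j.+1 * t%:R * T%:R ^+ j = T%:R ^- j :> R.
  rewrite tE natrX exprS -exprM mulnC exprM.
  by field; rewrite expf_neq0 gt_eqF.
rewrite le_eqVlt; apply/orP; left; apply/eqP.
transitivity (t%:R ^- j.+1 * t%:R * T%:R ^+ j * (j.+1%:R * (8 * ln (8 * N)%:R + 6)) *
    ((N%:R `^ b) ^+ j.+1 * k%:R `^ (- b))); first by ring.
by rewrite eT exprMn exprVn [_ ^+ j.+1]exprS; ring.
Qed.

Lemma normr_coefficient_diag_le (l k : nat) (phi : R) : (0 < k)%N ->
  `|coefficient N t T x l l k phi| <= N%:R ^+ l / k%:R.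
Proof.
move=> k0; rewrite /coefficient (le_trans (ler_norm_sum _ _ _)) //.
have tr : (0 : R) < t%:R by rewrite ltr0n.
have c0 : 0 <= t%:R ^- l * N%:R ^+ l :> R by rewrite mulr_ge0 ?invr_ge0 ?exprn_ge0.
rewrite (le_trans (_ : _ <= \sum_(i < t ^ l) t%:R ^- l * N%:R ^+ l / k%:R)) //.
  rewrite [leLHS]big_mkcond /=; apply: ler_sum => i _; case: ifP => _.
    by rewrite normrM (ger0_norm c0) ler_wpM2l // normr_arc_le.
  by rewrite mulr_ge0 // invr_ge0.
rewrite sumr_const card_ord -[_ *+ _]mulr_natl natrX.
by rewrite -!mulrA mulVKf // expf_neq0 // gt_eqF.
Qed.

(** Telescoping from level [l], where each cell is estimated by [1 / k]. That start costs [N ^ l],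
    which is admissible because the constant in (D2) may depend on [l]. *)
Lemma coefficient_decay (b : R) (l : nat) : 0 <= b <= 1 -> N%:R `^ b < T%:R ->
  exists C : R, forall (j k : nat) (phi : R), (0 < k)%N -> (l <= j)%N ->
    `|coefficient N t T x j l k phi| <= C * k%:R `^ (- b).
Proof.
move=> b01 NbT; have Tr : (0 : R) < T%:R by rewrite ltr0n.
set D : R := (8 * ln (8 * N)%:R + 6) * N%:R `^ b.
have D0 : 0 <= D.
  rewrite mulr_ge0 ?powR_ge0 // addr_ge0 // mulr_ge0 // ln_ge0 //.
  by rewrite ler1n muln_gt0.
pose theta : R := N%:R `^ b / T%:R.
have th0 : 0 <= theta by rewrite divr_ge0 ?powR_ge0.
have th01 : 0 <= theta < 1 by rewrite th0 ltr_pdivrMr // mul1r.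
exists (N%:R ^+ l + D * ((1 - theta) ^+ 2)^-1) => j k phi k0 lj.
have kb0 := powR_ge0 (k%:R : R) (- b).
suff H : `|coefficient N t T x j l k phi| <=
    (N%:R ^+ l + D * \sum_(i < j) i.+1%:R * theta ^+ i) * k%:R `^ (- b).
  rewrite (le_trans H) // ler_wpM2r // lerD2l ler_wpM2l //.
  exact: sum_arith_geom_le.
(* The induction is anchored at [j = l], which occurs either as [l = 0] in the base case or as
   [l = j.+1] in the step. *)
elim: j lj => [|j IH].
  rewrite leqn0 => /eqP ->.
  rewrite big_ord0 mulr0 addr0 (le_trans (normr_coefficient_diag_le _ _ _)) //.
  rewrite ler_wpM2l ?exprn_ge0 // -powR_inv1 // ler_powR ?ler1n // lerN2.
  by case/andP: b01.
rewrite leq_eqVlt => /predU1P[->|]; last rewrite ltnS => lj.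
  rewrite (le_trans (normr_coefficient_diag_le _ _ _)) //.
  rewrite ler_pM ?exprn_ge0 ?invr_ge0 // ?lerDl.
    rewrite mulr_ge0 // sumr_ge0 // => i _.
    by rewrite mulr_ge0 // exprn_ge0.
  rewrite -powR_inv1 // ler_powR ?ler1n // lerN2.
  by case/andP: b01.
rewrite -[coefficient _ _ _ _ _ _ _ _](subrK (coefficient N t T x j l k phi)).
rewrite (le_trans (ler_normD _ _)) //.
rewrite (le_trans (lerD (coefficient_increment_le phi lj k0 b01) (IH lj))) //.
rewrite big_ord_recr /= le_eqVlt; apply/orP; left; apply/eqP.
by rewrite /D /theta; ring.
Qed.

End coefficient_decay.

(** * The Cantor system of a family of shifts *)

Lemma addr_lt (N t : nat) (x : nat -> nat -> nat) (j n : nat) :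
  (0 < N)%N -> (addr N t x j n < N ^ j)%N.
Proof.
move=> N0; elim: j n => [|j IH] n //=.
have := IH (n %/ t)%N; have : ((n %% t + x j (n %/ t)) %% N < N)%N by rewrite ltn_pmod.
by rewrite expnS; nia.
Qed.

(** Division by [N] recovers the address of the parent, and the shift modulo [N] is injective on
    digits below [t <= N]. *)
Lemma addr_inj (N t : nat) (x : nat -> nat -> nat) (j m n : nat) :
  (0 < t)%N -> (t <= N)%N -> (m < t ^ j)%N -> (n < t ^ j)%N ->
  addr N t x j m = addr N t x j n -> m = n.
Proof.
move=> t0 tN; have N0 : (0 < N)%N by exact: leq_trans tN.
elim: j m n => [|j IH] m n; first by rewrite expn0; case: m n => [] [].
rewrite expnSr => mt nt /= e.
have e1 : addr N t x j (m %/ t) = addr N t x j (n %/ t).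
  have := congr1 (divn^~ N) e; rewrite ![(N * _)%N]mulnC !divnMDl //.
  by rewrite !(divn_small (ltn_pmod _ N0)) !addn0.
have e2 : (m %/ t)%N = (n %/ t)%N by apply: IH => //; rewrite ltn_divLR.
move: e; rewrite e1 e2 => /addnI/eqP.
have small k : ((k %% t) %% N = k %% t)%N.
  by rewrite modn_small // (leq_trans _ tN) // ltn_pmod.
rewrite eqn_modDr !small => /eqP e3.
by rewrite (divn_eq m t) (divn_eq n t) e2 e3.
Qed.

Section cantor_construction.
Variables (R : realType) (N0 t0 n0 : nat) (x : nat -> nat -> nat).
Hypotheses (t0_gt0 : (0 < t0)%N) (t0N0 : (t0 <= N0)%N).
Local Notation N := (sys_param N0 n0).
Local Notation t := (sys_param t0 n0).
Local Notation T := (t0 ^ n0)%N.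
Hypothesis x_special : forall j n, special t T j n -> x j n = 0%N.

Lemma sys_param_gt0 : (0 < t)%N. Proof. by rewrite expn_gt0 t0_gt0. Qed.
Lemma sys_param_le : (t <= N)%N. Proof. by rewrite /sys_param; case: (2 * n0)%N => [|e] //; rewrite leq_exp2r. Qed.
Lemma sys_paramE : t = (T ^ 2)%N. Proof. by rewrite /sys_param mulnC expnM. Qed.

Let t_gt0 := sys_param_gt0.
Let tN := sys_param_le.
Let N_gt0 : (0 < N)%N. Proof. exact: leq_trans tN. Qed.
Let T_gt0 : (0 < T)%N. Proof. by rewrite expn_gt0 t0_gt0. Qed.
Let Tt : (T <= t)%N. Proof. by rewrite sys_paramE -[leqLHS]expn1 leq_pexp2l. Qed.
Let NR : (0 : R) < N%:R. Proof. by rewrite ltr0n. Qed.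

Definition point (j i : nat) : R := (addr N t x j i)%:R / N%:R ^+ j.

Definition level (j : nat) : {fset R} := [fset point j i | i in iota 0 (t ^ j)]%fset.

(** A Cantor system indexes its digit sets by real points, whereas the shifts are indexed by node
    numbers; this inverts [point j] on the nodes of level [j]. *)
Definition node_of (j : nat) (a : R) : nat := find (fun i => point j i == a) (iota 0 (t ^ j)).

Definition digits (j : nat) (a : R) : {fset R} :=
  [fset (((r + x j.-1 (node_of j.-1 a)) %% N)%N%:R / N%:R ^+ j)%R | r in iota 0 t]%fset.

(** Written [0 + i * 1] to have literally the form asked for by [arithmetic_progression]. *)
Definition prog : {fset nat} := [fset (0 + i * 1)%N | i in iota 0 T]%fset.

Lemma point_inj (j m n : nat) : (m < t ^ j)%N -> (n < t ^ j)%N ->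
  point j m = point j n -> m = n.
Proof.
move=> mt nt /(mulIf _) e; apply: (addr_inj t_gt0 tN mt nt (x := x)).
by apply/eqP; rewrite -(eqr_nat R) e // invr_neq0 // expf_neq0 // gt_eqF.
Qed.

Lemma node_ofK (j i : nat) : (i < t ^ j)%N -> node_of j (point j i) = i.
Proof.
move=> it; set s := iota 0 (t ^ j); pose p n := point j n == point j i.
have hs : has p s by apply/hasP; exists i; rewrite ?mem_iota //= /p.
have ft : (find p s < t ^ j)%N by rewrite -[ltnRHS](size_iota 0) -has_find.
have := nth_find 0%N hs; rewrite nth_iota // add0n => /eqP; exact: point_inj.
Qed.

Lemma levelP (j : nat) (a : R) :
  reflect (exists2 i, (i < t ^ j)%N & a = point j i) (a \in level j).
Proof.
apply: (iffP (imfsetP _ _ _ _)) => [[i /= + ->]|[i it ->]].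
  by rewrite mem_iota => it; exists i.
by exists i => //=; rewrite mem_iota.
Qed.

Lemma point_child (j i r : nat) : (r < t)%N ->
  point j.+1 (i * t + r) = point j i + ((r + x j i) %% N)%:R / N%:R ^+ j.+1.
Proof.
move=> rt; rewrite /point /= divnMDl // divn_small // addn0 modnMDl (modn_small rt).
rewrite natrD natrM exprS; field.
by rewrite expf_neq0 ?gt_eqF.
Qed.

Lemma progP (k : nat) : (k \in prog) = (k < T)%N.
Proof.
apply/imfsetP/idP => [[i /= + ->]|kT]; first by rewrite mem_iota muln1.
by exists k; rewrite ?muln1 //= mem_iota.
Qed.

(** A special node has shift 0, and its digits [r < T <= N] do not wrap around, so its first [T]
    children are the translates by the elements of [prog]. *)
Lemma progression_setP (j : nat) (a : R) :
  reflect (exists i, [/\ (i < t ^ j)%N, special t T j i & a = point j i])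
    (a \in progression_set R N prog j).
Proof.
elim: j a => [|j IH] a /=.
  rewrite in_fset1; apply: (iffP eqP) => [->|[i [_ _ ->]]]; last by rewrite /point /= mul0r.
  by exists 0%N; rewrite /point /= mul0r.
have zero i r : special t T j i -> (r < T)%N -> ((r + x j i) %% N = r)%N.
  move=> si rT; rewrite x_special // addn0 modn_small //.
  exact: leq_trans rT (leq_trans Tt tN).
apply: (iffP (imfset2P _ _ _ _ _)).
  move=> [b /= /IH [i [it si ->]]] [r /=]; rewrite progP => rT ->.
  have rt : (r < t)%N by exact: leq_trans Tt.
  exists (i * t + r)%N; split.
  - by rewrite expnSr (leq_trans (_ : _ < i * t + t)%N) ?ltn_add2l // -mulSnr leq_mul2r it orbT.
  - by rewrite divnMDl // divn_small // addn0 modnMDl modn_small // si.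
  - by rewrite point_child // zero.
move=> [n [nt /andP[sn nT] ->]].
have nt' : (n %/ t < t ^ j)%N by rewrite ltn_divLR // -expnSr.
exists (point j (n %/ t)); first by apply/IH; exists (n %/ t)%N.
exists (n %% t)%N; first by rewrite /= progP.
by rewrite {1}(divn_eq n t) point_child ?ltn_pmod // zero.
Qed.

Lemma level0 : level 0 = [fset 0]%fset.
Proof.
apply/fsetP => a; rewrite in_fset1; apply/levelP/eqP => [[i _ ->]|->].
  by rewrite /point /= mul0r.
by exists 0%N => //; rewrite /point /= mul0r.
Qed.

Lemma digitsP (j i : nat) (b : R) : (i < t ^ j)%N ->
  reflect (exists2 r, (r < t)%N & b = ((r + x j i) %% N)%:R / N%:R ^+ j.+1)
    (b \in digits j.+1 (point j i)).
Proof.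
move=> it; rewrite /digits /= node_ofK //.
apply: (iffP (imfsetP _ _ _ _)) => [[r /= + ->]|[r rt ->]].
  by rewrite mem_iota => rt; exists r.
by exists r => //=; rewrite mem_iota.
Qed.

Lemma levelS (j : nat) :
  level j.+1 = [fset (a + b)%R | a in level j, b in digits j.+1 a]%fset.
Proof.
apply/fsetP => c; apply/levelP/imfset2P => /=.
  move=> [n nt ->].
  have nt' : (n %/ t < t ^ j)%N by rewrite ltn_divLR // -expnSr.
  exists (point j (n %/ t)); first by apply/levelP; exists (n %/ t)%N.
  exists (((n %% t + x j (n %/ t)) %% N)%:R / N%:R ^+ j.+1).
    by apply/digitsP => //; exists (n %% t)%N; rewrite ?ltn_pmod.
  by rewrite {1}(divn_eq n t) point_child ?ltn_pmod.
move=> [a /levelP[i it ->]] [b /digitsP -/(_ it)[r rt ->] ->].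
exists (i * t + r)%N; last by rewrite point_child.
by rewrite expnSr (leq_trans (_ : _ < i * t + t)%N) ?ltn_add2l // -mulSnr leq_mul2r it orbT.
Qed.

Lemma digits_sub (j : nat) (a : R) : a \in level j ->
  (digits j.+1 a `<=` scaled_digits R N j.+1)%fset.
Proof.
move=> /levelP[i it ->]; apply/fsubsetP => b /digitsP -/(_ it)[r rt ->].
apply/imfsetP; exists ((r + x j i) %% N)%N => //=.
by rewrite mem_iota ltn_pmod.
Qed.

Lemma card_digits (j : nat) (a : R) : a \in level j -> #|` digits j.+1 a|%fset = t.
Proof.
move=> /levelP[i it ->]; rewrite /digits card_in_imfset /=.
  by rewrite undup_id ?iota_uniq // size_iota.
move=> r s; rewrite !mem_iota /= => rt st /(mulIf _) e.
have /eqP : ((r + x j (node_of j (point j i))) %% N)%N%:R =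
    ((s + x j (node_of j (point j i))) %% N)%N%:R :> R.
  by apply: e; rewrite invr_neq0 // expf_neq0 // gt_eqF.
by rewrite eqr_nat eqn_modDr !modn_small ?(leq_trans _ tN) // => /eqP.
Qed.

Lemma progression_sub (j : nat) : (progression_set R N prog j `<=` level j)%fset.
Proof.
apply/fsubsetP => a /progression_setP[i [it _ ->]].
by apply/levelP; exists i.
Qed.

Lemma prog_ap : arithmetic_progression T prog.
Proof. by exists 0%N, 1%N. Qed.

Lemma prog_lt (k : nat) : k \in prog -> (k < N)%N.
Proof. by rewrite progP => /leq_trans; apply; exact: leq_trans Tt tN. Qed.

Definition shift_system : cantor_system R N0 t0 n0 :=
  CantorSystem prog_ap prog_lt level0 levelS digits_sub card_digits progression_sub.

End cantor_construction.

(** * Integrals against the approximating measures *)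

Lemma bounded_integrable d (X : measurableType d) (R : realType)
    (nu : {measure set X -> \bar R}) (D : set X) (h : X -> R) (M : R) :
  measurable D -> (nu D < +oo)%E -> measurable_fun setT h ->
  (forall x, `|h x| <= M) -> nu.-integrable D (EFin \o h).
Proof.
move=> mD nuD mh hM; apply: measurable_bounded_integrable => //.
  exact: measurable_funTS.
exists M; split; first exact: num_real.
by move=> N MN x _ /=; rewrite (le_trans (hM x)) // ltW.
Qed.

Lemma integrable_itv (R : realType) (a b : R) (h : R -> R) (M : R) :
  measurable_fun setT h -> (forall x, `|h x| <= M) ->
  (@lebesgue_measure R).-integrable `[a, b] (EFin \o h).
Proof.
move=> mh hM; apply: (@bounded_integrable _ _ R lebesgue_measure _ h M) => //.
by rewrite /= lebesgue_measure_itv /=; case: ifP => _; rewrite ?ltry // -EFinB ltry.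
Qed.

Section integral_approx.
Variables (R : realType) (N0 t0 n0 : nat) (x : nat -> nat -> nat).
Hypotheses (t0_gt0 : (0 < t0)%N) (t0N0 : (t0 <= N0)%N).
Local Notation N := (sys_param N0 n0).
Local Notation t := (sys_param t0 n0).
Local Notation T := (t0 ^ n0)%N.
Hypothesis x_special : forall j n, special t T j n -> x j n = 0%N.
Local Notation S := (shift_system R t0_gt0 t0N0 x_special).
Local Notation lam := (@lebesgue_measure R).
Local Notation pt := (point R N0 t0 n0 x).

Let t_gt0 : (0 < t)%N := sys_param_gt0 n0 t0_gt0.
Let N_gt0 : (0 < N)%N. Proof. exact: leq_trans (sys_param_le n0 t0N0). Qed.
Let NR : (0 : R) < N%:R. Proof. by rewrite ltr0n. Qed.

Lemma cell_lt (j i : nat) : pt j i < pt j i + N%:R ^- j.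
Proof. by rewrite ltrDl invr_gt0 exprn_gt0. Qed.

Lemma sum_level (V : nmodType) (j : nat) (G : R -> V) :
  \sum_(a <- level R N0 t0 n0 x j) G a = \sum_(i < t ^ j) G (pt j i).
Proof.
rewrite big_imfset /=; last first.
  by move=> m n; rewrite !mem_iota /=; exact: point_inj.
by rewrite undup_id ?iota_uniq // -(big_mkord xpredT (G \o pt j)) /index_iota subn0.
Qed.


Let weight_ge0 (j : nat) : 0 <= t%:R ^- j :> R.
Proof. by rewrite invr_ge0 exprn_ge0. Qed.

(** [mu_j] is identified with the sum over the cells of [t ^ - j] times the uniform probability on
    the cell; integrals against finite sums of measures then split. *)
Lemma ge0_integral_approx (j : nat) (f : R -> \bar R) :
  measurable_fun setT f -> (forall y, 0 <= f y)%E ->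
  (\int[cs_approx S j]_y f y =
  \sum_(i < t ^ j) (t%:R ^- j)%R%:E *
    ((N%:R ^+ j)%R%:E * \int[lam]_(y in `[pt j i, (pt j i + N%:R ^- j)%R]) f y))%E.
Proof.
move=> mf f0.
pose m (i : nat) : {measure set (measurableTypeR R) -> \bar R} :=
  mscale (NngNum (weight_ge0 j)) (uniform_prob (cell_lt j i)).
have e A : measurable A -> A `<=` setT -> cs_approx S j A = msum m (t ^ j) A.
  move=> mA _; pose u (i : 'I_(t ^ j)) (y : R) :=
    ((t%:R ^- j)%R%:E * (uniform_pdf (pt j i) (pt j i + N%:R ^- j) y)%:E)%E.
  have mpdf i : measurable_fun A
      (fun y => (uniform_pdf (pt j i) (pt j i + N%:R ^- j) y)%:E).
    by apply: measurableT_comp => //; apply: measurable_funTS; exact: measurable_uniform_pdf.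
  transitivity (\int[lam]_(y in A) \sum_(i < t ^ j) u i y)%E.
    rewrite /cs_approx; apply: eq_integral => y _.
    rewrite /cs_density /= sum_level -sumEFin.
    apply: eq_bigr => i _; rewrite /u -EFinM; congr EFin; rewrite -mulrA; congr (_ * _).
    rewrite /uniform_pdf indicE mem_setE /= in_itv /= [pt j i + _]addrC addrK invrK.
    by case: ifP => _; rewrite ?mulr1 ?mulr0.
  rewrite ge0_integral_sum //; last 2 first.
  - by move=> i; exact: measurable_funeM.
  - by move=> i y _; rewrite mule_ge0 // lee_fin // uniform_pdf_ge0 // cell_lt.
  rewrite /msum; apply: eq_bigr => i _; rewrite /u ge0_integralZl //.
    by move=> y _; rewrite lee_fin uniform_pdf_ge0 // cell_lt.
rewrite (eq_measure_integral (msum m (t ^ j))) //.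
rewrite ge0_integral_measure_sum //; apply: eq_bigr => i _.
rewrite /m ge0_integral_mscale //=; congr (_ * _)%E.
by rewrite integral_uniform // addrC addKr invrK.
Qed.

Lemma approx_setT_lty (j : nat) : (cs_approx S j setT < +oo)%E.
Proof.
rewrite -[X in (X < _)%E]mul1e -integral_cst //=.
rewrite ge0_integral_approx //.
under eq_bigr => i _.
  rewrite integral_cst //= lebesgue_measure_itv /= lte_fin cell_lt -EFinD -!EFinM.
  over.
by rewrite sumEFin ltry.
Qed.

(** Reduces to the nonnegative case by integrating [h + M] and cancelling the integral of the
    constant [M]. *)
Lemma Rintegral_approx (j : nat) (h : R -> R) (M : R) :
  measurable_fun setT h -> (forall y, `|h y| <= M) ->
  \int[cs_approx S j]_y h y =
  \sum_(i < t ^ j) t%:R ^- j *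
    (N%:R ^+ j * \int[lam]_(y in `[pt j i, pt j i + N%:R ^- j]) h y).
Proof.
move=> mh hM.
have ge0 (g : R -> R) (M' : R) : measurable_fun setT g -> (forall y, `|g y| <= M') ->
    (forall y, 0 <= g y) ->
    \int[cs_approx S j]_y g y =
    \sum_(i < t ^ j) t%:R ^- j *
      (N%:R ^+ j * \int[lam]_(y in `[pt j i, pt j i + N%:R ^- j]) g y).
  move=> mg gM g0; rewrite {1}/Rintegral ge0_integral_approx //; last exact: measurableT_comp.
  under eq_bigr => i _.
    rewrite -[X in (_ * (_ * X))%E]fineK; last first.
      by apply: integrable_fin_num => //; exact: integrable_itv gM.
    rewrite -!EFinM.
    over.
  by rewrite sumEFin.
have int1 (g : R -> R) M' : measurable_fun setT g -> (forall y, `|g y| <= M') ->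
    (cs_approx S j).-integrable setT (EFin \o g).
  move=> mg gM; apply: (@bounded_integrable _ _ R (cs_approx S j) _ g M') => //.
  exact: approx_setT_lty.
have M0 : 0 <= M by exact: le_trans (hM 0).
have eh : \int[cs_approx S j]_y (h y + M) =
    \int[cs_approx S j]_y h y + \int[cs_approx S j]_y M.
  by rewrite RintegralD //; [exact: int1 hM|apply: (int1 _ M) => // y; rewrite ger0_norm].
have mcst : measurable_fun setT (cst M : R -> R) by [].
have cM (y : R) : `|cst M y| <= M by rewrite /= ger0_norm.
apply: (addIr (\int[cs_approx S j]_y M)).
rewrite -eh (ge0 (fun y => h y + M) (M + M)); first last.
- by move=> y; have := hM y; rewrite ler_norml => /andP[+ _]; lra.
- by move=> y; rewrite (le_trans (ler_normD _ _)) // lerD // ger0_norm.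
- exact: measurable_funD.
rewrite (ge0 (cst M) M) // -big_split /=; apply: eq_bigr => i _.
rewrite RintegralD //; [|exact: integrable_itv hM|exact: integrable_itv cM].
by rewrite -mulrDr -mulrDr.
Qed.

End integral_approx.

Lemma Rintegral_cos_itv (R : realType) (a delta phi : R) (k : nat) :
  (0 < k)%N -> 0 < delta ->
  \int[@lebesgue_measure R]_(y in `[a, a + delta]) cos (2 * pi * k%:R * y + phi)
    = arc a delta k phi.
Proof.
move=> k0 d0.
have c0 : 2 * pi * k%:R != 0 :> R.
  by rewrite !mulf_neq0 // ?pnatr_eq0 -?lt0n // gt_eqF // pi_gt0.
set c := 2 * pi * k%:R in c0 *.
pose F y : R := c^-1 * sin (c * y + phi).
have dF (y : R) : is_derive y (1 : R) F (cos (c * y + phi)).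
  have dl : is_derive y (1 : R) (fun z => c * z + phi) c.
    by apply: is_derive_eq; rewrite /GRing.scale /= mulr1 addr0.
  have ds : is_derive y (1 : R) (sin \o (fun z => c * z + phi)) (cos (c * y + phi) * c).
    exact: is_derive1_comp.
  apply: (@is_derive_eq _ _ _ _ _ _ _ _ (is_deriveZ (c^-1) ds)).
  by rewrite /GRing.scale /= mulrCA mulVf // mulr1.
have cF : continuous F.
  by move=> y; apply: differentiable_continuous; apply/derivable1_diffP; have [] := dF y.
rewrite /Rintegral (@continuous_FTC2 _ _ F) ?ltrDl //.
- by rewrite /arc -/c /F /=; field.
- apply: continuous_subspaceT => y; apply: continuous_comp; last exact: continuous_cos.
  by apply: cvgD; [apply: cvgM; [exact: cvg_cst|exact: cvg_id]|exact: cvg_cst].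
- split.
  + by move=> y _; have [] := dF y.
  + exact/cvg_at_right_filter/cF.
  + exact/cvg_at_left_filter/cF.
- by move=> y _; rewrite derive1E; have [_ ->] := dF y.
Qed.

Section cells.
Variables (R : realType) (N0 t0 n0 : nat) (x : nat -> nat -> nat).
Hypotheses (t0_gt0 : (0 < t0)%N) (t0N0 : (t0 <= N0)%N).
Local Notation N := (sys_param N0 n0).
Local Notation t := (sys_param t0 n0).
Local Notation T := (t0 ^ n0)%N.
Hypothesis x_special : forall j n, special t T j n -> x j n = 0%N.
Local Notation S := (shift_system R t0_gt0 t0N0 x_special).
Local Notation lam := (@lebesgue_measure R).
Local Notation pt := (point R N0 t0 n0 x).

Let t_gt0 : (0 < t)%N := sys_param_gt0 n0 t0_gt0.
Let N_gt0 : (0 < N)%N. Proof. exact: leq_trans (sys_param_le n0 t0N0). Qed.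
Let NR : (0 : R) < N%:R. Proof. by rewrite ltr0n. Qed.

Lemma point_ge0 (j i : nat) : 0 <= pt j i.
Proof. by rewrite divr_ge0 // exprn_ge0. Qed.

Lemma point_le1 (j i : nat) : pt j i + N%:R ^- j <= 1.
Proof.
rewrite /point -[X in _ + X]mul1r -mulrDl ler_pdivrMr ?exprn_gt0 // mul1r.
by rewrite natr1 -natrX ler_nat addr_lt.
Qed.

(** Addresses are integers, so two half-open cells of one level that meet have the same address,
    hence belong to the same node. *)
Lemma cell_uniq (j m n : nat) (y : R) : (m < t ^ j)%N -> (n < t ^ j)%N ->
  pt j m <= y < pt j m + N%:R ^- j -> pt j n <= y < pt j n + N%:R ^- j -> m = n.
Proof.
move=> mt nt /andP[m1 m2] /andP[n1 n2].
have Nj : (0 : R) < N%:R ^+ j by rewrite exprn_gt0.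
have lt k1 k2 : pt j k1 <= y -> y < pt j k2 + N%:R ^- j ->
    (addr N t x j k1 <= addr N t x j k2)%N.
  move=> h1 h2; have := le_lt_trans h1 h2.
  rewrite /point -[X in _ < _ + X]mul1r -mulrDl ltr_pM2r ?invr_gt0 //.
  by rewrite natr1 ltr_nat ltnS.
apply: (addr_inj t_gt0 (sys_param_le n0 t0N0) mt nt (x := x)).
by apply/eqP; rewrite eqn_leq !lt.
Qed.

Lemma cell_parent (j n : nat) :
  pt j (n %/ t) <= pt j.+1 n /\
  pt j.+1 n + N%:R ^- j.+1 <= pt j (n %/ t) + N%:R ^- j.
Proof.
have Nj : (0 : R) < N%:R ^+ j by rewrite exprn_gt0.
have Nj1 : (0 : R) < N%:R ^+ j.+1 by rewrite exprn_gt0.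
rewrite {2 3}(divn_eq n t) point_child ?ltn_pmod //; set d := (_ %% N)%N.
have dN : (d < N)%N by rewrite ltn_pmod.
split; first by rewrite lerDl divr_ge0 // ltW.
rewrite -addrA lerD2l -[X in _ + X]mul1r -mulrDl natr1.
have -> : N%:R ^- j = N%:R / N%:R ^+ j.+1 :> R.
  by rewrite exprS; field; rewrite ?gt_eqF.
by rewrite ler_pM2r ?invr_gt0 // ler_nat.
Qed.

Lemma cell_ancestor (j l n : nat) : (l <= j)%N ->
  pt l (n %/ t ^ (j - l)) <= pt j n /\
  pt j n + N%:R ^- j <= pt l (n %/ t ^ (j - l)) + N%:R ^- l.
Proof.
elim: j n => [|j IH] n; first by rewrite leqn0 => /eqP ->; rewrite divn1.
rewrite leq_eqVlt => /predU1P[->|]; first by rewrite subnn divn1.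
rewrite ltnS => lj; have [h1 h2] := IH (n %/ t)%N lj.
rewrite subSn // expnS divnMA; have [h3 h4] := cell_parent j n.
by split; [exact: le_trans h3|exact: le_trans h4 _].
Qed.

Lemma ancestor_lt (j l n : nat) : (l <= j)%N -> (n < t ^ j)%N ->
  (n %/ t ^ (j - l) < t ^ l)%N.
Proof. by move=> lj nt; rewrite ltn_divLR ?expn_gt0 ?t0_gt0 // -expnD subnKC. Qed.

Lemma cs_FP (l : nat) (y : R) :
  cs_F S l y <-> exists i, [/\ (i < t ^ l)%N, special t T l i &
    pt l i <= y < pt l i + N%:R ^- l].
Proof.
split=> [[a /= /(progression_setP t0_gt0 t0N0 x_special)[i [it si ->]]]|[i [it si yi]]].
  by rewrite in_itv /= => yi; exists i.
exists (pt l i) => /=; last by rewrite in_itv.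
by apply/(progression_setP t0_gt0 t0N0 x_special); exists i.
Qed.

Lemma measurable_cs_F (l : nat) : measurable (cs_F S l : set (measurableTypeR R)).
Proof. by apply: fin_bigcup_measurable => [|a _]; [exact: finite_fset|exact: measurable_itv]. Qed.

(** Half-open cells are nested across levels and disjoint within a level, so the only cell of level
    [l] that can contain [y] is the ancestor of its cell of level [j]. *)
Lemma cs_f_cell (j l n : nat) (y : R) : (l <= j)%N -> (n < t ^ j)%N ->
  pt j n <= y < pt j n + N%:R ^- j ->
  cs_f S l y = (special t T l (n %/ t ^ (j - l)))%:R.
Proof.
move=> lj nt /andP[y1 y2]; rewrite /cs_f indicE; congr (nat_of_bool _)%:R.
have [h1 h2] := cell_ancestor n lj.
have yl : pt l (n %/ t ^ (j - l)) <= y < pt l (n %/ t ^ (j - l)) + N%:R ^- l.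
  by rewrite (le_trans h1 y1) (lt_le_trans y2 h2).
apply/idP/idP => [/set_mem/cs_FP[i [it si yi]]|sn].
  by rewrite -(cell_uniq it (ancestor_lt lj nt) yi yl).
by apply/mem_set/cs_FP; exists (n %/ t ^ (j - l))%N; split=> //; exact: ancestor_lt.
Qed.

(** Stated for a general [f] so as to cover both [f_l] and, with [l = 0], the constant 1: at level 0
    the only node is special. *)
Lemma Rintegral_approx_cos (j l k : nat) (phi : R) (f : R -> R) :
  (0 < k)%N -> measurable_fun setT f -> (forall y, `|f y| <= 1) ->
  (forall n y, (n < t ^ j)%N -> pt j n <= y < pt j n + N%:R ^- j ->
    f y = (special t T l (n %/ t ^ (j - l)))%:R) ->
  \int[cs_approx S j]_y (f y * cos (2 * pi * k%:R * y + phi)) =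
  coefficient N t T x j l k phi.
Proof.
move=> k0 mf f1 fE.
have ccos : continuous (fun y : R => cos (2 * pi * k%:R * y + phi)).
  move=> y; apply: continuous_comp; last exact: continuous_cos.
  by apply: cvgD; [apply: cvgM; [exact: cvg_cst|exact: cvg_id]|exact: cvg_cst].
have mc : measurable_fun setT (fun y : R => cos (2 * pi * k%:R * y + phi)).
  exact: continuous_measurable_fun.
have m1 : measurable_fun setT (fun y => f y * cos (2 * pi * k%:R * y + phi)).
  exact: measurable_funM.
have b1 y : `|f y * cos (2 * pi * k%:R * y + phi)| <= 1.
  by rewrite normrM -[leRHS]mulr1 ler_pM // cos_max.
rewrite (Rintegral_approx _ _ _ _ m1 b1) /coefficient [RHS]big_mkcond /=.
apply: eq_bigr => i _; rewrite mulrA; set w := t%:R ^- j * _.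
have cl := @cell_lt R N0 t0 n0 x t0_gt0 t0N0 j i.
(* The density lives on closed cells and [f] is known on half-open ones; the endpoint is a null
   set. *)
have co (g : R -> R) : measurable_fun setT g -> (forall y, `|g y| <= 1) ->
   \int[lam]_(y in `[pt j i, pt j i + N%:R ^- j]) g y =
   \int[lam]_(y in `[pt j i, pt j i + N%:R ^- j[) g y.
  move=> mg g1; rewrite Rintegral_itv_bndo_bndc //.
  apply: integrableS (integrable_itv _ _ mg g1) => //.
  by apply: subset_itvl; rewrite bnd_simp.
rewrite co //; transitivity (w * \int[lam]_(y in `[pt j i, pt j i + N%:R ^- j[)
   ((special t T l (i %/ t ^ (j - l)))%:R * cos (2 * pi * k%:R * y + phi))).
  congr (_ * _); apply: eq_Rintegral => y /set_mem; rewrite /= in_itv /= => yi.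
  by rewrite (fE i).
case: ifP => _.
  under eq_Rintegral do rewrite mul1r.
  rewrite -co // ?Rintegral_cos_itv // => [|y]; last exact: cos_max.
  by rewrite invr_gt0 exprn_gt0.
under eq_Rintegral do rewrite mul0r.
by rewrite Rintegral_cst //= mul0r mulr0.
Qed.

End cells.

(** * From trigonometric integrals to the decay conditions *)

Lemma normc_le (R : rcfType) (a b : R) : Normc.normc (Complex a b) <= `|a| + `|b|.
Proof.
rewrite /Normc.normc /= -[leRHS]ger0_norm ?addr_ge0 //.
rewrite -(sqrtr_sqr (`|a| + `|b|)) ler_sqrt ?sqr_ge0 //.
have := mulr_ge0 (normr_ge0 a) (normr_ge0 b).
by rewrite sqrrD !real_normK ?num_real //; lra.
Qed.

Lemma normr_int_natabs (R : realType) (k : int) : `|k%:~R| = `|k|%N%:R :> R.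
Proof. by rewrite -intr_norm -abszE pmulrn. Qed.

(** The real part is the phase 0 at [|k|]; the imaginary part is the phase [pi / 2] for [k >= 0] and
    [- pi / 2] for [k < 0]. *)
Lemma normc_fourier_fun_int_le (R : realType)
    (nu : {measure set (measurableTypeR R) -> \bar R}) (f : R -> R) (k : int) (A : R) :
  (forall phi, `|\int[nu]_y (f y * cos (2 * pi * `|k|%N%:R * y + phi))| <= A) ->
  Normc.normc (fourier_fun nu f k%:~R) <= 2 * A.
Proof.
move=> H; rewrite /fourier_fun (le_trans (normc_le _ _)) //.
have hc : `|\int[nu]_y (f y * cos (- (2 * pi * y * k%:~R)))| <= A.
  apply: le_trans (H 0); rewrite le_eqVlt; apply/orP; left.
  apply/eqP; congr (`|_|); apply: eq_Rintegral => y _; congr (_ * _).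
  rewrite addr0 cosN -[RHS]cos_norm -[LHS]cos_norm; congr cos.
  by rewrite !normrM normr_int_natabs (ger0_norm (ler0n _ `|k|)); ring.
have hs : `|\int[nu]_y (f y * sin (- (2 * pi * y * k%:~R)))| <= A.
  have [k0|k0] := leP 0 k.
    apply: le_trans (H (pi / 2)); rewrite le_eqVlt; apply/orP; left.
    apply/eqP; congr (`|_|); apply: eq_Rintegral => y _; congr (_ * _).
    rewrite cosDpihalf sinN -[in LHS](gez0_abs k0); congr (- sin _).
    by rewrite pmulrn; ring.
  apply: le_trans (H (- (pi / 2))); rewrite le_eqVlt; apply/orP; left.
  apply/eqP; congr (`|_|); apply: eq_Rintegral => y _; congr (_ * _).
  rewrite cosBpihalf; congr sin; rewrite -[in LHS](opprK k) -(ltz0_abs k0).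
  by rewrite [in RHS]pmulrn mulrNz; ring.
by rewrite [leRHS]mulr_natl mulr2n lerD.
Qed.

Section fourier_decay.
Variables (R : realType) (N0 t0 n0 : nat) (x : nat -> nat -> nat).
Hypotheses (t0_gt0 : (0 < t0)%N) (t0N0 : (t0 <= N0)%N).
Local Notation N := (sys_param N0 n0).
Local Notation t := (sys_param t0 n0).
Local Notation T := (t0 ^ n0)%N.
Hypothesis x_special : forall j n, special t T j n -> x j n = 0%N.
Local Notation S := (shift_system R t0_gt0 t0N0 x_special).
Local Notation pt := (point R N0 t0 n0 x).

Variable beta : R.
Hypothesis beta_ge0 : 0 <= beta.
Hypothesis decay : forall l, exists C : R, forall (j k : nat) (phi : R),
  (0 < k)%N -> (l <= j)%N ->
  `|coefficient N t T x j l k phi| <= C * k%:R `^ (- (beta / 2)).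

Lemma uniform_fourier_decay_shift_system : uniform_fourier_decay S beta.
Proof.
move=> l; have [C HC] := decay l; exists (2 * C) => k j k0 lj.
rewrite -mulrA; apply: normc_fourier_fun_int_le => phi.
have kn : (0 < `|k|)%N by rewrite absz_gt0.
rewrite (@Rintegral_approx_cos _ _ _ _ _ _ _ _ j l) //.
- by rewrite normr_int_natabs; exact: HC.
- exact: measurable_indic (measurable_cs_F _ _ _ _).
- by move=> y; rewrite /cs_f indicE; case: (_ \in _); rewrite ?normr1 ?normr0.
- by move=> n y nt yn; rewrite (cs_f_cell _ _ _ lj nt yn).
Qed.

(** For [l = 0] the bound on [mu_j] is uniform in [j], and it passes to the limit because cosines
    are bounded and continuous. *)
Lemma fourier_decay_weak_limit (mu : probability (measurableTypeR R) R) :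
  weak_limit (fun j => cs_approx S j) mu -> fourier_decay mu beta.
Proof.
move=> muS; have [C HC] := decay 0; exists (2 * C) => k k0.
have kn : (0 < `|k|)%N by rewrite absz_gt0.
rewrite -mulrA; apply: normc_fourier_fun_int_le => phi.
(* The factor 1 is the function [cst 1] in the definition of [fourier]. *)
pose h (y : R) := 1 * cos (2 * pi * `|k|%N%:R * y + phi).
have ch : continuous h.
  move=> y; apply: cvgM; first exact: cvg_cst.
  apply: continuous_comp; last exact: continuous_cos.
  by apply: cvgD; [apply: cvgM; [exact: cvg_cst|exact: cvg_id]|exact: cvg_cst].
have bh : exists M : R, forall y, `|h y| <= M.
  by exists 1 => y; rewrite /h mul1r cos_max.
apply: (cvgr_to_le (cvg_norm (muS h ch bh))).
apply: nearW => j; rewrite (@Rintegral_approx_cos _ _ _ _ _ _ _ _ j 0) //.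
  by rewrite normr_int_natabs; exact: HC.
by move=> y; rewrite normr1.
Qed.

End fourier_decay.

(** * The limit measure *)

Section unit_interval_cells.
Variable R : realType.
Local Notation unif := (uniform_prob (@ltr01 R)).

Lemma measurable_fun_truncn (c : R) (H : nat -> R) :
  measurable_fun setT (fun u : measurableTypeR R => H (Num.truncn (u * c))).
Proof.
move=> _ B mB; rewrite setTI.
have -> : (fun u => H (Num.truncn (u * c))) @^-1` B =
    \bigcup_(n in H @^-1` B) [set u | Num.truncn (u * c) = n].
  apply/seteqP; split=> [u /= Bu|u [n /= Bn e]]; last by rewrite /= e.
  by exists (Num.truncn (u * c)).
have mlt (a : R) : measurable [set u : measurableTypeR R | u * c < a].
  have mm : measurable_fun setT (fun u : measurableTypeR R => u * c).
    by apply: measurable_funM => //; exact: measurable_cst.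
  have := mm measurableT _ (measurable_itv `]-oo, a[); rewrite setTI.
  by congr measurable; apply/seteqP; split=> u /=; rewrite in_itv.
(* [Num.truncn] is 0 on negative reals, so its fibre over 0 is a half-line and needs a separate
   case. *)
apply: bigcup_measurable => -[|n] _.
  rewrite (_ : mkset _ = [set u | u * c < 0.+1%:R]); first exact: mlt.
  apply/seteqP; split=> u /=; first by move=> e; rewrite -truncn_le_nat e.
  by rewrite -truncn_le_nat leqn0 => /eqP.
rewrite (_ : mkset _ = [set u | u * c < n.+2%:R] `\` [set u | u * c < n.+1%:R]).
  exact: measurableD.
apply/seteqP; split=> u /=.
  by move=> e; rewrite -!truncn_le_nat e leqnn ltnn.
rewrite -!truncn_le_nat => -[h1 /negP h2]; apply/eqP.
by rewrite eqn_leq h1 ltnNge h2.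
Qed.

Lemma uniform01_cell (n i : nat) : (i < n)%N ->
  unif `[i%:R / n%:R, i.+1%:R / n%:R[ = (n%:R^-1)%:E.
Proof.
move=> i_n; have n0 : (0 : R) < n%:R by rewrite ltr0n (leq_ltn_trans _ i_n).
have lt1 : i.+1%:R / n%:R <= 1 :> R by rewrite ler_pdivrMr // mul1r ler_nat.
have ge0 : 0 <= i%:R / n%:R :> R by rewrite divr_ge0.
rewrite /uniform_prob integral_uniform_pdf.
rewrite (_ : _ `&` _ = `[i%:R / n%:R, i.+1%:R / n%:R[%classic); last first.
  apply/seteqP; split=> [u [] //|u /= ui]; split=> //.
  move: ui; rewrite !in_itv /= => /andP[u1 u2].
  by rewrite (le_trans ge0 u1) ltW // (lt_le_trans u2).
rewrite (eq_integral (cst 1%:E)); last first.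
  move=> u; rewrite inE /= in_itv /= => /andP[u1 u2].
  by rewrite /uniform_pdf subr0 invr1 (le_trans ge0 u1) ltW // (lt_le_trans u2).
rewrite integral_cst //= mul1e lebesgue_measure_itv /= lte_fin.
rewrite ltr_pM2r ?invr_gt0 // ltr_nat ltnSn -EFinB -mulrBl.
by rewrite -natrB // subSnn mul1r.
Qed.

Lemma truncn_cell (n i : nat) (u : R) : (0 < n)%N ->
  0 <= u -> (Num.truncn (u * n%:R) == i) = (u \in `[i%:R / n%:R, i.+1%:R / n%:R[).
Proof.
move=> n0 u0; have nr : (0 : R) < n%:R by rewrite ltr0n.
by rewrite truncn_eq ?mulr_ge0 // in_itv /= ler_pdivrMr // ltr_pdivlMr.
Qed.

Lemma integral_uniform01_truncn (n : nat) (H : nat -> R) : (0 < n)%N ->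
  (\int[unif]_u (H (Num.truncn (u * n%:R)))%:E =
   (n%:R^-1 * \sum_(i < n) H i)%:E)%E.
Proof.
move=> n0; have nr : (0 : R) < n%:R by rewrite ltr0n.
pose c (i : 'I_n) : set (measurableTypeR R) :=
  `[i%:R / n%:R, i.+1%:R / n%:R[%classic.
have mind (i : 'I_n) : measurable_fun setT (fun u : measurableTypeR R => (H i * \1_(c i) u)%:E).
  by apply: measurableT_comp => //; apply: measurable_funM => //;
    apply: measurable_indic; exact: measurable_itv.
have one : unif `[0, 1[ = 1%E.
  by have := @uniform01_cell 1 0 isT; rewrite mul0r divr1 invr1.
have m01 : measurable (`[0, 1[%classic : set (measurableTypeR R)) by exact: measurable_itv.
have null : unif (~` `[0, 1[%classic) = 0%E.
  rewrite probability_setC // [X in (_ - X)%E](_ : _ = 1%E) ?subee //.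
have indint (i : 'I_n) : unif.-integrable setT (EFin \o (\1_(c i) : measurableTypeR R -> R)).
  apply: (@bounded_integrable _ _ R unif _ _ 1) => //.
  - by apply: (le_lt_trans (probability_le1 unif measurableT)); exact: ltry.
  - by apply: measurable_indic; exact: measurable_itv.
  - by move=> u; rewrite indicE; case: (_ \in _); rewrite ?normr1 ?normr0.
rewrite (@ae_eq_integral _ _ _ _ _ (fun u => \sum_(i < n) (H i * \1_(c i) u)%:E)%E) //.
- rewrite integral_sum //.
    rewrite mulr_sumr -sumEFin; apply: eq_bigr => i _.
    under eq_integral do rewrite EFinM.
    rewrite integralZl //; last exact: (indint i).
    rewrite integral_indic // ?setIT; last exact: measurable_itv.
    by rewrite mulrC EFinM; congr (_ * _)%E; exact: uniform01_cell.
  move=> i; under eq_fun do rewrite EFinM.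
  by apply: integrableZl => //; exact: (indint i).
- by apply: measurableT_comp => //; exact: measurable_fun_truncn.
- exact: emeasurable_sum.
- exists (~` `[0, 1[%classic); split=> //; first exact: measurableC.
  move=> u /= nu u01; apply: nu => _; move: u01; rewrite in_itv /= => /andP[u0 u1].
  have kn : (Num.truncn (u * n%:R) < n)%N.
    by rewrite truncn_lt_nat ?mulr_ge0 // gtr_pMl.
  have cE (i : 'I_n) : c i u <-> Num.truncn (u * n%:R) = i.
    by split=> [|/eqP]; [rewrite /c /= -truncn_cell // => /eqP|rewrite truncn_cell].
  rewrite (bigD1 (Ordinal kn)) //= big1.
    by rewrite adde0 indicE mem_set ?mulr1 //; exact/cE.
  move=> i ik; rewrite indicE memNset ?mulr0 // => /cE e.
  by move: ik; rewrite -val_eqE /= e eqxx.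
Qed.

End unit_interval_cells.

Lemma normr_itv_average_le (R : realType) (a delta c eps B : R) (f : R -> R) :
  0 < delta -> measurable_fun setT f -> (forall y, `|f y| <= B) ->
  (forall y, a <= y <= a + delta -> `|f y - c| <= eps) ->
  `|delta^-1 * \int[@lebesgue_measure R]_(y in `[a, a + delta]) f y - c| <= eps.
Proof.
move=> d0 mf fB fc.
have cst_int (r : R) : \int[@lebesgue_measure R]_(y in `[a, a + delta]) r = r * delta.
  rewrite Rintegral_cst //= lebesgue_measure_itv /= lte_fin ltrDl d0 -EFinB /=.
  by rewrite addrC addKr.
have int_cst (r : R) : (@lebesgue_measure R).-integrable `[a, a + delta] (EFin \o cst r).
  by apply: (@integrable_itv _ _ _ _ `|r|) => //; exact: measurable_cst.
have int_f := integrable_itv a (a + delta) mf fB.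
have bounds y : `[a, a + delta]%classic y -> c - eps <= f y <= c + eps.
  by rewrite /= in_itv /= => /fc; rewrite ler_distl.
have lo : (c - eps) * delta <= \int[@lebesgue_measure R]_(y in `[a, a + delta]) f y.
  rewrite -cst_int; apply: le_Rintegral => //; first exact: int_cst.
  by move=> y /bounds /andP[].
have hi : \int[@lebesgue_measure R]_(y in `[a, a + delta]) f y <= (c + eps) * delta.
  rewrite -cst_int; apply: le_Rintegral => //; first exact: int_cst.
  by move=> y /bounds /andP[].
rewrite ler_distl; apply/andP; split.
  by rewrite mulrC ler_pdivlMr.
by rewrite mulrC ler_pdivrMr.
Qed.

Section limit_measure.
Variables (R : realType) (N0 t0 n0 : nat) (x : nat -> nat -> nat).
Hypotheses (t0_gt0 : (0 < t0)%N) (t0N0 : (t0 <= N0)%N).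
Local Notation N := (sys_param N0 n0).
Local Notation t := (sys_param t0 n0).
Local Notation T := (t0 ^ n0)%N.
Hypothesis x_special : forall j n, special t T j n -> x j n = 0%N.
Local Notation S := (shift_system R t0_gt0 t0N0 x_special).
Local Notation lam := (@lebesgue_measure R).
Local Notation unif := (uniform_prob (@ltr01 R)).
Local Notation pt := (point R N0 t0 n0 x).

Let t_gt0 : (0 < t)%N := sys_param_gt0 n0 t0_gt0.
Let N_gt0 : (0 < N)%N. Proof. exact: leq_trans (sys_param_le n0 t0N0). Qed.
Let NR : (0 : R) < N%:R. Proof. by rewrite ltr0n. Qed.

(** For [u] in [0, 1), the node given by the first [j] base [t] digits of [u]; a uniform [u] thus
    follows a random branch of the tree. *)
Definition node_at (j : nat) (u : R) : nat := Num.truncn (u * (t ^ j)%:R).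

Lemma node_at_parent (j : nat) (u : R) : (node_at j.+1 u %/ t)%N = node_at j u.
Proof.
rewrite /node_at expnSr natrM mulrA.
have tr : (0 : R) < t%:R by rewrite ltr0n.
set v := u * _; have [v0|v0] := leP 0 v; last first.
  have lt0 (w : R) : w < 0 -> Num.truncn w = 0%N :> nat.
    by move=> w0; apply/eqP; rewrite -leqn0 truncn_le_nat (lt_trans w0).
  by rewrite !lt0 ?div0n // pmulr_llt0.
apply/esym/truncn_def; set n := Num.truncn _.
have /andP[n1 n2] : n%:R <= v * t%:R < n.+1%:R by rewrite truncn_itv // mulr_ge0.
rewrite -(ler_pM2r tr) -(ltr_pM2r tr) -!natrM.
apply/andP; split.
  by rewrite (le_trans _ n1) // ler_nat leq_divM.
by rewrite (lt_le_trans n2) // ler_nat ltn_ceil.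
Qed.

Lemma node_at_lt (j : nat) (u : R) : u < 1 -> (node_at j u < t ^ j)%N.
Proof.
move=> u1; have tj : (0 : R) < (t ^ j)%:R by rewrite ltr0n expn_gt0 t_gt0.
have [u0|u0] := leP 0 u.
  by rewrite truncn_lt_nat ?mulr_ge0 // gtr_pMl.
rewrite (_ : node_at j u = 0%N) ?expn_gt0 ?t0_gt0 //.
by apply/eqP; rewrite -leqn0 truncn_le_nat (@lt_trans _ _ 0) // pmulr_llt0.
Qed.

(** The coding map: the point on which the cells along the branch of [u] close down. Left ends of
    nested cells increase, so the limit exists. *)
Definition limit_point (u : R) : R := limn (fun j => pt j (node_at j u)).

Lemma left_end_nested (u : R) (i j : nat) : (i <= j)%N ->
  pt i (node_at i u) <= pt j (node_at j u) /\
  pt j (node_at j u) + N%:R ^- j <= pt i (node_at i u) + N%:R ^- i.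
Proof.
elim: j => [|j IH]; first by rewrite leqn0 => /eqP ->.
rewrite leq_eqVlt => /predU1P[-> //|]; rewrite ltnS => ij.
have [h1 h2] := IH ij.
have [h3 h4] := @cell_parent R N0 t0 n0 x t0_gt0 t0N0 j (node_at j.+1 u).
rewrite node_at_parent in h3 h4.
by split; [exact: le_trans h3|exact: le_trans h4 _].
Qed.

Lemma cvg_limit_point (u : R) : pt j (node_at j u) @[j --> \oo] --> limit_point u.
Proof.
apply: nondecreasing_is_cvgn.
  by move=> i j ij; have [] := left_end_nested u ij.
exists 1 => _ [j _ <-]; apply: le_trans (@point_le1 R N0 t0 n0 x t0_gt0 t0N0 j (node_at j u)).
by rewrite lerDl invr_ge0 exprn_ge0.
Qed.

Lemma limit_point_cell (u : R) (j : nat) :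
  pt j (node_at j u) <= limit_point u <= pt j (node_at j u) + N%:R ^- j.
Proof.
apply/andP; split.
  apply: (cvgr_to_ge (cvg_limit_point (u := u))); exists j => // i /= ji.
  by have [] := left_end_nested u ji.
apply: (cvgr_to_le (cvg_limit_point (u := u))); exists j => // i /= ji.
have [_] := left_end_nested u ji; apply: le_trans.
by rewrite lerDl invr_ge0 exprn_ge0.
Qed.

Lemma measurable_limit_point :
  measurable_fun setT (limit_point : measurableTypeR R -> R).
Proof.
apply: (@measurable_fun_cvg _ _ _ _ (fun j u => pt j (node_at j u))).
  by move=> j; exact: measurable_fun_truncn.
by move=> u _; exact: cvg_limit_point.
Qed.

Lemma limit_point_limit_set (u : R) : u < 1 -> cs_limit_set S (limit_point u).
Proof.
move=> u1 j _; exists (pt j (node_at j u)) => /=.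
  by apply/levelP; exists (node_at j u) => //; exact: node_at_lt.
by rewrite in_itv /= limit_point_cell.
Qed.

Lemma measurable_limit_set : measurable (cs_limit_set S : set (measurableTypeR R)).
Proof.
apply: bigcapT_measurable => j.
by apply: fin_bigcup_measurable => [|a _]; [exact: finite_fset|exact: measurable_itv].
Qed.

(** A limit point is only known to lie in closed cells. Specialness at level [l.+1] puts it in a
    subcell of index [r < T < N], whose right end lies strictly before that of the cell of level
    [l]; [1 < T] gives [T < T ^ 2 <= N]. *)
Lemma limit_point_cs_F (u : R) (l : nat) : (1 < T)%N -> u < 1 ->
  special t T l.+1 (node_at l.+1 u) -> cs_F S l (limit_point u).
Proof.
move=> T1 u1 /= /andP[sl rT]; rewrite node_at_parent in sl.
apply/cs_FP; exists (node_at l u); split=> //; first exact: node_at_lt.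
have TN : (T < N)%N.
  apply: leq_trans (sys_param_le n0 t0N0); rewrite sys_paramE.
  by rewrite -[ltnLHS]expn1 ltn_exp2l.
have rt : (node_at l.+1 u %% t < t)%N by rewrite ltn_pmod.
have /andP[g1 g2] := limit_point_cell u l.+1.
have := @point_child R N0 t0 n0 x t0_gt0 t0N0 l (node_at l u) _ rt.
rewrite -{1}(node_at_parent l u) -divn_eq x_special // addn0 => e.
rewrite e in g1 g2; rewrite modn_small in g1 g2; last exact: ltn_trans TN.
have Nl : (0 : R) < N%:R ^+ l.+1 by rewrite exprn_gt0.
apply/andP; split; first by rewrite (le_trans _ g1) // lerDl divr_ge0 // ltW.
rewrite (le_lt_trans g2) // -addrA ltrD2l -[X in _ + X]mul1r -mulrDl natr1.
have -> : N%:R ^- l = N%:R / N%:R ^+ l.+1 :> R.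
  rewrite exprS; field.
  by rewrite expf_neq0 ?gt_eqF.
by rewrite ltr_pM2r ?invr_gt0 // ltr_nat (leq_ltn_trans rT).
Qed.

End limit_measure.

Lemma uniform01_unit (R : realType) : uniform_prob (@ltr01 R) `[0, 1[ = 1%E.
Proof. by have := @uniform01_cell R 1 0 isT; rewrite mul0r divr1 invr1. Qed.

(** [mu] is the law of [limit_point u] for [u] uniform on [0, 1]. Integrating [f] against [mu_j] is
    averaging over [u] the mean [H] of [f] on the cell of [node_at j u]. These cells shrink to
    [limit_point u], and dominated convergence gives the weak limit. For the mass bound,
    [T ^ (l + 1)] of the [T ^ (2 (l + 1))] nodes of level [l.+1] are special. *)
Lemma exists_cantor_measure (R : realType) (N0 t0 n0 : nat) (x : nat -> nat -> nat)
    (t0_gt0 : (0 < t0)%N) (t0N0 : (t0 <= N0)%N)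
    (x_special : forall j n, special (sys_param t0 n0) (t0 ^ n0) j n -> x j n = 0%N)
    (S := shift_system R t0_gt0 t0N0 x_special) :
  (1 < t0 ^ n0)%N ->
  exists mu : probability (measurableTypeR R) R, cantor_measure S mu /\
    forall l, (((t0 ^ n0)%:R ^- l.+1)%:E <= mu (cs_F S l))%E.
Proof.
move=> T1; set N := sys_param N0 n0; set t := sys_param t0 n0.
pose pt := point R N0 t0 n0 x; pose unif : probability (measurableTypeR R) R := uniform_prob (@ltr01 R).
have t_gt0 : (0 < t)%N by exact: sys_param_gt0.
have tE : t = ((t0 ^ n0) ^ 2)%N by exact: sys_paramE.
have N1 : (1 < N)%N.
  apply: leq_trans (sys_param_le n0 t0N0); rewrite -/t tE.
  by rewrite (leq_trans T1) // -[leqLHS]expn1 leq_pexp2l // ltnW.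
have N_gt0 := ltnW N1.
have NR : (0 : R) < N%:R by rewrite ltr0n.
have tj j : (0 < t ^ j)%N by rewrite expn_gt0 t_gt0.
pose g : measurableTypeR R -> measurableTypeR R := limit_point N0 t0 n0 x.
have mg : measurable_fun setT g by exact: measurable_limit_point.
pose X : {mfun measurableTypeR R >-> measurableTypeR R} :=
  MeasurableFun.Pack (MeasurableFun.Class (isMeasurableFun.Build _ _ _ _ g mg)).
exists (distribution unif X); split; first split.
- move=> f cf [B fB].
  have mf : measurable_fun setT f by exact: continuous_measurable_fun.
  pose H j i := N%:R ^+ j * \int[@lebesgue_measure R]_(y in `[pt j i, pt j i + N%:R ^- j]) f y.
  have Nj j : 0 < N%:R ^- j :> R by rewrite invr_gt0 exprn_gt0.
  have HE j i c eps : (forall y, pt j i <= y <= pt j i + N%:R ^- j -> `|f y - c| <= eps) ->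
      `|H j i - c| <= eps.
    move=> h; rewrite /H -[X in X * _]invrK.
    exact: (normr_itv_average_le (Nj j) mf fB h).
  have HB j i : `|H j i| <= B.
    by rewrite -[H j i]subr0; apply: HE => y _; rewrite subr0.
  have e1 j : (\int[cs_approx S j]_y f y = fine (\int[unif]_u (H j (node_at t0 n0 j u))%:E)).
    rewrite (Rintegral_approx _ _ _ _ mf fB) (integral_uniform01_truncn _ (tj j)) /=.
    by rewrite natrX mulr_sumr.
  have e2 : \int[distribution unif X]_y f y = fine (\int[unif]_u (f (g u))%:E).
    rewrite /Rintegral integral_distribution //.
      exact: measurableT_comp.
    apply: (@bounded_integrable _ _ R unif _ (f \o g) B) => //.
    + by apply: (le_lt_trans (probability_le1 unif measurableT)); exact: ltry.
    + exact: measurableT_comp.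
    + by move=> u; exact: fB.
  rewrite e2; under eq_fun do rewrite e1.
  have intB : unif.-integrable setT (cst B%:E).
    apply: (@bounded_integrable _ _ R unif _ (cst B) `|B|) => //.
    by apply: (le_lt_trans (probability_le1 unif measurableT)); exact: ltry.
  have mH j : measurable_fun setT (fun u : measurableTypeR R => (H j (node_at t0 n0 j u))%:E).
    by apply: measurableT_comp => //; exact: measurable_fun_truncn.
  have mfg : measurable_fun setT (fun u : measurableTypeR R => (f (g u))%:E).
    by apply: measurableT_comp => //; exact: measurableT_comp.
  have Hfg (u : R) : H j (node_at t0 n0 j u) @[j --> \oo] --> f (g u).
    apply/cvgrPdist_le => eps eps0.
    have /cvgrPdist_le/(_ _ eps0) := cf (g u).
    rewrite -nbhs_ballE => -[d /= d0 fd].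
    have : (fun j => N%:R^-1 ^+ j : R) j @[j --> \oo] --> 0.
      by apply: cvg_expr; rewrite ger0_norm ?invf_lt1 ?ltr1n // invr_ge0.
    move=> /cvgrPdist_lt/(_ _ d0)[j0 _ Hj0].
    exists j0 => // j /= jj0; rewrite distrC; apply: HE => y yj.
    rewrite distrC; apply: fd; rewrite /ball /=.
    have := Hj0 j jj0; rewrite /= sub0r normrN exprVn (ger0_norm (ltW (Nj j))).
    apply: le_lt_trans; rewrite ler_distl.
    have := @limit_point_cell R N0 t0 n0 x t0_gt0 t0N0 u j.
    rewrite -/N -/(pt _ _) -/(g u).
    move: yj => /andP[y1 y2] /andP[g1 g2]; apply/andP; split; lra.
  have Hfg' (u : R) : (H j (node_at t0 n0 j u))%:E @[j --> \oo] --> (f (g u))%:E.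
    by apply: cvg_EFin; [exact: nearW|exact: Hfg].
  have aecvg : {ae unif, forall u, setT u ->
      (H j (node_at t0 n0 j u))%:E @[j --> \oo] --> (f (g u))%:E}.
    by apply: aeW => u _; exact: Hfg'.
  have aebd : {ae unif, forall u j, setT u ->
      (`|(H j (node_at t0 n0 j u))%:E| <= cst B%:E u)%E}.
    by apply: aeW => u j _; rewrite lee_fin; exact: HB.
  have [intfg _ cvgH] := dominated_convergence measurableT mH mfg aecvg intB aebd.
  apply: fine_cvg; rewrite fineK; first exact: cvgH.
  exact: integrable_fin_num.
- have mL : measurable (cs_limit_set S : set (measurableTypeR R)).
    exact: measurable_limit_set.
  have h : `[0, 1[%classic `<=` g @^-1` cs_limit_set S.
    by move=> u /=; rewrite in_itv /= => /andP[_ u1]; exact: limit_point_limit_set.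
  apply/eqP; rewrite eq_le; apply/andP; split.
    exact: probability_le1.
  rewrite -(uniform01_unit R); apply: le_measure; rewrite ?inE //.
  rewrite -[X in measurable X]setTI; exact: (mg measurableT _ mL).
(* The condition [i < t ^ l.+1] discards [u >= 1], where [node_at] leaves the tree. *)
- move=> l; pose H i := ((special t (t0 ^ n0) l.+1 i && (i < t ^ l.+1)%N)%:R : R).
  have mF : measurable (cs_F S l : set (measurableTypeR R)) by exact: measurable_cs_F.
  have mA : measurable (g @^-1` cs_F S l).
    by rewrite -[X in measurable X]setTI; exact: (mg measurableT _ mF).
  apply: (@le_trans _ _ (\int[unif]_u (\1_(g @^-1` cs_F S l) u)%:E)%E); last first.
    by rewrite integral_indic // setIT.
  have -> : ((t0 ^ n0)%:R ^- l.+1)%:E = (\int[unif]_u (H (node_at t0 n0 l.+1 u))%:E)%E.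
    rewrite (integral_uniform01_truncn _ (tj _)); congr EFin.
    under eq_bigr => i _ do rewrite /H ltn_ord andbT.
    rewrite (eq_bigr (fun i : 'I__ => if special t (t0 ^ n0) l.+1 i then 1 else 0)); last first.
      by move=> i _; case: (special _ _ _ _).
    rewrite -big_mkcond /= sum_special //; last first.
      by rewrite tE -[leqLHS]expn1 leq_pexp2l // ltnW.
    rewrite tE -expnM mulnC expnM (natrX _ _ 2) (natrX _ (t0 ^ n0) l.+1).
    have : (t0 ^ n0)%:R ^+ l.+1 != 0 :> R by rewrite expf_neq0 // pnatr_eq0 -lt0n ltnW.
    by move=> ?; field.
  apply: ge0_le_integral => //=.
  + by move=> u _; rewrite lee_fin.
  + by apply: measurableT_comp => //; exact: measurable_fun_truncn.
  + by apply: measurableT_comp => //; exact: measurable_indic.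
  move=> u _; rewrite lee_fin /H; case: andP => [[su ut]|_]; last by rewrite indicE ler0n.
  rewrite indicE mem_set //=; apply: limit_point_cs_F => //.
  have tl : (0 : R) < (t ^ l.+1)%:R by rewrite ltr0n.
  rewrite ltNge; apply/negP => u1; move: ut.
  by rewrite ltnNge truncn_ge_nat ?mulr_ge0 ?ler_peMl // (le_trans _ u1).
Qed.

(** * The lower bound for the extension operator *)

(* freq N m l n - offset N m l, n < (2 m + 1) ^ l, are the integers
   \sum_(i < l) d_i N ^ i with |d_i| <= m. *)
Fixpoint freq (N m l n : nat) : nat :=
  if l is i.+1 then (freq N m i (n %/ (2 * m).+1) * N + n %% (2 * m).+1)%N else 0%N.

Fixpoint offset (N m l : nat) : nat :=
  if l is i.+1 then (offset N m i * N + m)%N else 0%N.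

Lemma freq_inj (N m l n1 n2 : nat) : ((2 * m).+1 <= N)%N ->
  (n1 < (2 * m).+1 ^ l)%N -> (n2 < (2 * m).+1 ^ l)%N ->
  freq N m l n1 = freq N m l n2 -> n1 = n2.
Proof.
move=> mN; have N0 : (0 < N)%N by exact: leq_trans mN.
set W := (2 * m).+1 in mN *.
elim: l n1 n2 => [|l IH] n1 n2; first by rewrite expn0; case: n1 n2 => [] [].
rewrite expnSr => n1W n2W /= e.
have lt k : (k %% W < N)%N by rewrite (leq_trans _ mN) // ltn_pmod.
have e1 : freq N m l (n1 %/ W) = freq N m l (n2 %/ W).
  by have := congr1 (divn^~ N) e; rewrite !divnMDl // !(divn_small (lt _)) !addn0.
have e2 : (n1 %/ W = n2 %/ W)%N by apply: IH => //; rewrite ltn_divLR.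
move: e; rewrite -/W e1 => /addnI e3.
by rewrite (divn_eq n1 W) (divn_eq n2 W) e2 e3.
Qed.

(** * Products of Dirichlet kernels on the sets [F_l] *)

Section dirichlet.
Variable R : realType.
Implicit Types theta y : R.

Definition dirichlet (m : nat) y : R :=
  \sum_(r < (2 * m).+1) cos (2 * pi * y * (r%:R - m%:R)).

Lemma sum_sin_symmetric (m : nat) y :
  \sum_(r < (2 * m).+1) sin (2 * pi * y * (r%:R - m%:R)) = 0.
Proof.
set A := \sum_(_ < _) _; suff : A = - A by move=> e; lra.
rewrite {1}/A (reindex_inj rev_ord_inj) /= -sumrN; apply: eq_bigr => r _.
have -> : (rev_ord r)%:R - m%:R = - (r%:R - m%:R) :> R.
  rewrite /rev_ord [nat_of_ord _]/= subSS natrB; last by rewrite -ltnS ltn_ord.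
  by rewrite natrM; ring.
by rewrite mulrN sinN.
Qed.

Lemma sum_cos_shift (m : nat) theta y :
  \sum_(r < (2 * m).+1) cos (theta + 2 * pi * y * (r%:R - m%:R)) = cos theta * dirichlet m y.
Proof.
under eq_bigr do rewrite cosD.
by rewrite sumrB -!mulr_sumr sum_sin_symmetric mulr0 subr0.
Qed.

(** A sum over independent digits factors into one kernel for each digit. This works with cosines
    alone since the digits are symmetric about 0 and the sine sums vanish. The induction peels off
    the lowest digit and replaces [y] by [N y]. *)
Lemma sum_cos_freq (N m l : nat) y :
  \sum_(n < (2 * m).+1 ^ l) cos (2 * pi * y * ((freq N m l n)%:R - (offset N m l)%:R))
  = \prod_(i < l) dirichlet m (N%:R ^+ i * y).
Proof.
elim: l y => [|l IH] y.
  by rewrite expn0 big_ord_recl !big_ord0 /= addr0 subrr mulr0 cos0.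
rewrite expnSr (big_ord_mul_nested _ _ (fun n =>
  cos (2 * pi * y * ((freq N m l.+1 n)%:R - (offset N m l.+1)%:R)))).
under eq_bigr => n _.
  under eq_bigr => r _.
    rewrite /= divnMDl // divn_small // addn0 modnMDl (modn_small (ltn_ord r)).
    rewrite !natrD !natrM (_ : 2 * pi * y * _ =
      2 * pi * (N%:R * y) * ((freq N m l n)%:R - (offset N m l)%:R)
      + 2 * pi * y * (r%:R - m%:R)); last by ring.
    over.
  rewrite sum_cos_shift.
  over.
rewrite -mulr_suml IH big_ord_recl /= expr0 mul1r mulrC; congr (_ * _).
by apply: eq_bigr => i _; rewrite /bump /= add1n exprSr mulrA.
Qed.

(** Modulo [2 pi] all the angles are at most [1 / 2], so each of the [2 m + 1] cosines is at least
    [1 / 2]. *)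
Lemma dirichlet_ge (m z : nat) y : 2 * pi * `|y - z%:R| * m%:R <= 1 / 2 ->
  (2 * m).+1%:R / 2 <= dirichlet m y.
Proof.
move=> yz; have -> : (2 * m).+1%:R / 2 = \sum_(r < (2 * m).+1) (1 / 2) :> R.
  by rewrite sumr_const card_ord -[RHS]mulr_natl mul1r.
apply: ler_sum => r _.
(* The distance [|r - m|] as a natural number, so that [2 pi z d] is a period. *)
pose d := (maxn r m - minn r m)%N.
have dm : (d <= m)%N by have := ltn_ord r; rewrite /d /maxn /minn; case: ifP; lia.
have -> : cos (2 * pi * y * (r%:R - m%:R)) = cos (2 * pi * y * d%:R).
  rewrite /d; have [rm|rm] := leqP r m.
    by rewrite natrB // -[LHS]cosN; congr cos; ring.
  by rewrite natrB // ltnW.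
rewrite (_ : 2 * pi * y * d%:R = 2 * pi * (y - z%:R) * d%:R + 2 * pi * (z * d)%:R); last first.
  by rewrite natrM; ring.
rewrite cosD2pin; apply: cos_ge_half; apply: le_trans yz.
rewrite !normrM !normr_nat ger0_norm ?pi_ge0 //.
by rewrite ler_wpM2l ?mulr_ge0 ?pi_ge0 // ler_nat.
Qed.

End dirichlet.

Lemma special_ancestor (t T j l n : nat) : (l <= j)%N ->
  special t T j n -> special t T l (n %/ t ^ (j - l)).
Proof.
elim: j n => [|j IH] n; first by rewrite leqn0 => /eqP ->.
rewrite leq_eqVlt => /predU1P[->|]; first by rewrite subnn divn1.
rewrite ltnS => lj /= /andP[sn _].
by rewrite subSn // expnS divnMA; exact: IH.
Qed.

Section cosine_sum_on_F.
Variables (R : realType) (N0 t0 n0 : nat) (x : nat -> nat -> nat).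
Hypotheses (t0_gt0 : (0 < t0)%N) (t0N0 : (t0 <= N0)%N).
Local Notation N := (sys_param N0 n0).
Local Notation t := (sys_param t0 n0).
Local Notation T := (t0 ^ n0)%N.
Hypothesis x_special : forall j n, special t T j n -> x j n = 0%N.
Local Notation S := (shift_system R t0_gt0 t0N0 x_special).
Local Notation pt := (point R N0 t0 n0 x).

Let t_gt0 : (0 < t)%N := sys_param_gt0 n0 t0_gt0.
Let N_gt0 : (0 < N)%N. Proof. exact: leq_trans (sys_param_le n0 t0N0). Qed.
Let NR : (0 : R) < N%:R. Proof. by rewrite ltr0n. Qed.

(** The ancestor of [y] at level [i.+1] is special, so its last digit is unshifted and below [T];
    hence [N ^ i y] exceeds the integer address at level [i] by at most [T / N]. *)
Lemma cs_F_frac (l i : nat) (y : R) : (i < l)%N -> cs_F S l y ->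
  exists z : nat, 0 <= N%:R ^+ i * y - z%:R <= T%:R / N%:R.
Proof.
move=> il /cs_FP[a [at_ sa /andP[y1 y2]]].
pose b := (a %/ t ^ (l - i.+1))%N.
have [h1 h2] := @cell_ancestor R N0 t0 n0 x t0_gt0 t0N0 l i.+1 a il.
have /= /andP[_ rT] := special_ancestor il sa; rewrite -/b in h1 h2 rT.
have sb : special t T i (b %/ t).
  by have /= /andP[] := special_ancestor il sa.
have bt : (b %% t < t)%N by rewrite ltn_pmod.
have e := @point_child R N0 t0 n0 x t0_gt0 t0N0 i (b %/ t)%N _ bt.
rewrite -divn_eq x_special // addn0 in e.
exists (addr N t x i (b %/ t)).
have Ni : (0 : R) < N%:R ^+ i by rewrite exprn_gt0.
have dT : ((b %% t) %% N < T)%N by rewrite (leq_ltn_trans (leq_mod _ _)).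
have r1 : ((b %% t) %% N)%:R + 1 <= T%:R :> R by rewrite natr1 ler_nat.
have {h1}y1 : pt i.+1 b <= y by exact: le_trans y1.
have {h2}y2 : y <= pt i.+1 b + N%:R ^- i.+1 by rewrite ltW // (lt_le_trans y2).
rewrite {}e /point in y1 y2.
have r0 : 0 <= ((b %% t) %% N)%:R / N%:R ^+ i.+1 :> R by rewrite divr_ge0 // exprn_ge0 // ltW.
apply/andP; split.
  rewrite subr_ge0 mulrC -ler_pdivrMr //; lra.
rewrite lerBlDl mulrC -ler_pdivlMr // (le_trans y2) //.
have -> : ((addr N t x i (b %/ t))%:R + T%:R / N%:R) / N%:R ^+ i =
    (addr N t x i (b %/ t))%:R / N%:R ^+ i + T%:R / N%:R ^+ i.+1 :> R.
  by rewrite exprS; field; rewrite ?gt_eqF.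
rewrite -addrA lerD2l -[X in _ + X]mul1r -mulrDl ler_pM2r //.
by rewrite invr_gt0 exprn_gt0.
Qed.

Lemma sum_cos_freq_ge (l m : nat) (y : R) : (16 * m * T <= N)%N -> cs_F S l y ->
  ((2 * m).+1%:R / 2) ^+ l <=
  \sum_(n < (2 * m).+1 ^ l) cos (2 * pi * y * ((freq N m l n)%:R - (offset N m l)%:R)).
Proof.
move=> mTN Fy; rewrite sum_cos_freq -[l in leLHS]card_ord -prodr_const.
apply: ler_prod => i _; rewrite divr_ge0 //=.
have [z /andP[z0 z1]] := cs_F_frac (ltn_ord i) Fy.
apply: (dirichlet_ge (z := z)); rewrite ger0_norm //.
have mr : (0 : R) <= m%:R by [].
have p4 := @pi_lt4 R; have p2 := @pi_ge2 R.
(* The 16 in the condition on [m] comes from [2 pi < 8] and the angle [1 / 2]. *)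
have h : 8 * (T%:R / N%:R) * m%:R <= 1 / 2 :> R.
  rewrite mulrA mulrAC ler_pdivrMr //.
  have : (16 * m * T)%:R <= N%:R :> R by rewrite ler_nat.
  by rewrite !natrM; lra.
apply: le_trans h; apply: ler_wpM2r => //.
by apply: ler_pM => //; lra.
Qed.

End cosine_sum_on_F.

(** * From sums over frequencies to [L^p] norms *)

Lemma Lnorm_ge_bumps (R : realType) (p h : R) (K : nat) (k w : nat -> R) (G : R -> R) :
  0 < p -> 0 < h -> measurable_fun setT G -> (forall xi, 0 <= G xi) ->
  (forall n, 0 <= w n) ->
  (forall m n xi, (m < K)%N -> (n < K)%N ->
     k m <= xi < k m + h -> k n <= xi < k n + h -> m = n) ->
  (forall n xi, (n < K)%N -> k n <= xi < k n + h -> w n <= G xi) ->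
  (((h * \sum_(n < K) w n `^ p) `^ p^-1)%:E
    <= 'N[@lebesgue_measure R]_(p%:E) [EFin \o G])%E.
Proof.
move=> p0 h0 mG G0 w0 disj wG.
pose I (n : nat) : set (measurableTypeR R) := `[k n, k n + h[%classic.
have mI n : measurable (I n) by exact: measurable_itv.
have mGp : measurable_fun setT (fun xi : measurableTypeR R => G xi `^ p).
  exact: (measurableT_comp (measurable_powR p) mG).
rewrite Lnorm.unlock -poweR_EFin; apply: gt0_ler_poweR; rewrite ?invr_ge0 ?(ltW p0) //.
- by rewrite in_itv /= leey andbT lee_fin mulr_ge0 ?(ltW h0) // sumr_ge0 // => n _; exact: powR_ge0.
- by rewrite in_itv /= leey andbT integral_ge0 // => xi _; exact: poweR_ge0.
have -> : ((h * \sum_(n < K) w n `^ p)%:E =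
    \int[@lebesgue_measure R]_xi \sum_(n < K) (w n `^ p * \1_(I n) xi)%:E)%E.
  rewrite ge0_integral_sum //; last 2 first.
  - by move=> n; apply: measurableT_comp => //; apply: measurable_funM.
  - by move=> n xi _; rewrite lee_fin mulr_ge0 ?powR_ge0.
  rewrite mulr_sumr -sumEFin; apply: eq_bigr => n _.
  under eq_integral do rewrite EFinM.
  rewrite ge0_integralZl //; last by rewrite lee_fin powR_ge0.
    rewrite integral_indic // setIT /= lebesgue_measure_itv /= lte_fin ltrDl h0.
    by rewrite -EFinB -EFinM addrC addKr mulrC.
  exact: measurableT_comp.
apply: ge0_le_integral => //=.
- by move=> xi _; apply: sume_ge0 => n _; rewrite lee_fin mulr_ge0 ?powR_ge0.
- apply: emeasurable_sum => n; by apply: measurableT_comp => //; apply: measurable_funM.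
- under eq_fun do rewrite ger0_norm //.
  exact: measurableT_comp.
move=> xi _; rewrite sumEFin lee_fin ger0_norm //.
have [[n Hn]|Hn] := pselect (exists n : 'I_K, I n xi).
  rewrite (bigD1 n) //= big1 => [|i ni].
    rewrite addr0 indicE mem_set // mulr1 ge0_ler_powR ?nnegrE ?(ltW p0) //.
    by apply: wG => //; move: Hn; rewrite /I /= in_itv.
  rewrite indicE memNset ?mulr0 // => Hi.
  move: ni Hi Hn; rewrite /I /= !in_itv /= => ni Hi Hn.
  by move: ni; rewrite -val_eqE /= (disj i n xi) ?eqxx.
rewrite big1 ?powR_ge0 // => i _; rewrite indicE memNset ?mulr0 // => Hi.
by apply: Hn; exists i.
Qed.

Section restricted_transform.
Variables (R : realType) (mu : probability (measurableTypeR R) R).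
Variable F : set (measurableTypeR R).
Hypotheses (mF : measurable F) (F01 : forall y, F y -> `|y : R| <= 1).

(** For [c] equal to [cos] or [sin], a component of the Fourier transform of the restriction of [mu]
    to [F]; both need the same estimates. *)
Definition trig_transform (c : R -> R) (xi : R) : R :=
  \int[mu]_y (\1_F y * c (- (2 * pi * y * xi))).

Let mu_lty : (mu setT < +oo)%E.
Proof. by apply: (le_lt_trans (probability_le1 mu measurableT)); exact: ltry. Qed.

Lemma integrable_indic_mul (g : R -> R) :
  measurable_fun setT (g : measurableTypeR R -> R) -> (forall y, `|g y| <= 2) ->
  mu.-integrable setT (EFin \o (fun y => \1_F y * g y)).
Proof.
move=> mg g2; apply: (@bounded_integrable _ _ R mu _ (fun y => \1_F y * g y) 2) => //.
  by apply: measurable_funM => //; exact: (measurable_indic mF).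
move=> y; rewrite normrM indicE.
by case: (_ \in _); rewrite ?normr1 ?normr0 ?mul1r ?mul0r.
Qed.

Lemma Rintegral_indic_mass : \int[mu]_y (\1_F y : R) = fine (mu F).
Proof. by rewrite /Rintegral integral_indic // setIT. Qed.

Section trig.
Variable c : R -> R.
Hypotheses (cc : continuous c) (c1 : forall z, `|c z| <= 1).
Hypothesis clip : forall a b, `|c a - c b| <= `|a - b|.

Lemma measurable_trig (xi : R) :
  measurable_fun setT (fun y : measurableTypeR R => c (- (2 * pi * y * xi))).
Proof.
apply: continuous_measurable_fun => y; apply: continuous_comp; last exact: cc.
apply: cvgN; apply: cvgM; last exact: cvg_cst.
by apply: cvgM; [exact: cvg_cst|exact: cvg_id].
Qed.

(** The phase has slope at most [2 pi < 8] on [F]. The factor [mu F] is essential: it makes the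
    width of the intervals around the frequencies independent of the mass. *)
Lemma trig_transform_lipschitz (xi eta : R) :
  `|trig_transform c xi - trig_transform c eta| <= 8 * fine (mu F) * `|xi - eta|.
Proof.
have i1 z : mu.-integrable setT (EFin \o (fun y => \1_F y * c (- (2 * pi * y * z)))).
  apply: integrable_indic_mul; first exact: measurable_trig.
  by move=> y; rewrite (le_trans (c1 _)) // ler1n.
rewrite /trig_transform -RintegralB //.
have i2 : mu.-integrable setT (EFin \o (fun y => \1_F y * c (- (2 * pi * y * xi))
    - \1_F y * c (- (2 * pi * y * eta)))).
  by have := integrableB measurableT (i1 xi) (i1 eta); apply: eq_integrable.
rewrite (le_trans (le_normr_Rintegral _ i2)) //.
have i3 : mu.-integrable setT (EFin \o (\1_F : measurableTypeR R -> R)).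
  apply: (@bounded_integrable _ _ R mu _ _ 1) => //.
  by move=> y; rewrite indicE; case: (_ \in _); rewrite ?normr1 ?normr0.
have -> : 8 * fine (mu F) * `|xi - eta| = \int[mu]_y (8 * `|xi - eta| * \1_F y).
  by rewrite RintegralZl // Rintegral_indic_mass; ring.
apply: le_Rintegral => //.
- exact: (integrable_norm i2).
- by have := integrableZl measurableT (8 * `|xi - eta|) i3; apply: eq_integrable.
move=> y _; rewrite -mulrBr normrM indicE.
have [Fy|_] := boolP (y \in F); last by rewrite normr0 mul0r mulr0.
rewrite normr1 mul1r mulr1 (le_trans (clip _ _)) //.
rewrite (_ : - (2 * pi * y * xi) - - (2 * pi * y * eta) = - (2 * pi * y * (xi - eta))); last by ring.
rewrite normrN !normrM ler_wpM2r // normr_nat (ger0_norm (pi_ge0 R)).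
have := F01 (set_mem Fy); have := @pi_lt4 R; have := @pi_ge0 R => pi0 pi4 y1.
have : 2 * pi * `|y : R| <= 2 * pi * 1 by rewrite ler_wpM2l // mulr_ge0.
lra.
Qed.

Lemma continuous_trig_transform : continuous (trig_transform c).
Proof.
have v0 : 0 <= fine (mu F) by exact: fine_ge0.
move=> xi; apply/cvgrPdist_le => eps eps0.
have d0 : 0 < eps / (8 * fine (mu F) + 1) by rewrite divr_gt0 //; lra.
exists (eps / (8 * fine (mu F) + 1)) => //= eta; rewrite /ball /= => xe.
rewrite (le_trans (trig_transform_lipschitz _ _)) //.
have : (8 * fine (mu F) + 1) * `|xi - eta| <= eps.
  by rewrite mulrC -ler_pdivlMr ?ltW //; lra.
have := normr_ge0 (xi - eta); lra.
Qed.

End trig.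

Lemma measurable_normc_fourier :
  measurable_fun setT (fun xi : R => Normc.normc (fourier_fun mu (\1_F) xi)).
Proof.
apply: continuous_measurable_fun => xi.
have cC := continuous_trig_transform (@continuous_cos R) (@cos_max R) (@cos_lipschitz R).
have cS := continuous_trig_transform (@continuous_sin R) (@sin_max R) (@sin_lipschitz R).
rewrite /Normc.normc /fourier_fun.
apply: (@continuous_comp _ _ _ (fun z => trig_transform cos z ^+ 2 + trig_transform sin z ^+ 2)
   (@Num.sqrt R)); last exact: sqrt_continuous.
apply: cvgD; rewrite !expr2.
  by apply: cvgM; exact: cC.
by apply: cvgM; exact: cS.
Qed.

Lemma trig_transform_le_normc (xi : R) :
  trig_transform cos xi <= Normc.normc (fourier_fun mu (\1_F) xi).
Proof.
rewrite /Normc.normc /fourier_fun /= (le_trans (ler_norm _)) // -sqrtr_sqr.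
rewrite ler_sqrt ?addr_ge0 ?sqr_ge0 // lerDl sqr_ge0 //.
Qed.

End restricted_transform.

Lemma Rintegral_ord_sum d (X : measurableType d) (R : realType)
    (nu : {measure set X -> \bar R}) (n : nat) (f : nat -> X -> R) :
  (forall i, nu.-integrable setT (EFin \o f i)) ->
  \int[nu]_y \sum_(i < n) f i y = \sum_(i < n) \int[nu]_y f i y.
Proof.
move=> fi; rewrite /Rintegral.
under eq_integral do rewrite -sumEFin.
rewrite integral_sum //; last by move=> i; exact: fi.
rewrite -[RHS]/(fine (\sum_(i < n) fine (\int[nu]_y (f i y)%:E)%E)%:E) -sumEFin.
congr fine; apply: eq_bigr => i _; rewrite fineK //.
by apply: integrable_fin_num => //; exact: fi.
Qed.

(** A lower bound linear in [g], hence summable over frequencies, in place of a power mean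
    inequality; it tolerates values of [g] that are small or negative. For [w < a] the left side is
    at most 0; otherwise [w ^ p >= a ^ (p - 1) w]. *)
Lemma powR_ge_tangent (R : realType) (a g p : R) : 0 < a -> 1 <= p ->
  a `^ (p - 1) * (g - 2 * a) <= Num.max 0 (g - a) `^ p.
Proof.
move=> a0 p1; set w := Num.max 0 (g - a).
have w0 : 0 <= w by rewrite /w le_max lexx.
have gw : g - a <= w by rewrite /w le_max lexx orbT.
have ap := powR_ge0 a (p - 1).
have [wa|aw] := ltP w a.
  apply: (@le_trans _ _ 0); last exact: powR_ge0.
  by rewrite mulr_ge0_le0 //; lra.
rewrite -(@mulr_powRB1 _ w p) ?(lt_le_trans _ p1) // mulrC.
apply: (@le_trans _ _ (w * a `^ (p - 1))).
  by rewrite ler_wpM2r //; lra.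
rewrite ler_wpM2l // ge0_ler_powR ?nnegrE ?(ltW a0) // subr_ge0 //.
Qed.

Lemma powR_exprn (R : realType) (b s : R) (l : nat) : 0 <= b ->
  (b ^+ l) `^ s = (b `^ s) ^+ l.
Proof. by move=> b0; rewrite -powR_mulrn // powRAC powR_mulrn ?powR_ge0. Qed.

Section extension_lower_bound.
Variables (R : realType) (N0 t0 n0 : nat) (x : nat -> nat -> nat).
Hypotheses (t0_gt0 : (0 < t0)%N) (t0N0 : (t0 <= N0)%N).
Local Notation N := (sys_param N0 n0).
Local Notation t := (sys_param t0 n0).
Local Notation T := (t0 ^ n0)%N.
Hypothesis x_special : forall j n, special t T j n -> x j n = 0%N.
Local Notation S := (shift_system R t0_gt0 t0N0 x_special).
Variable mu : probability (measurableTypeR R) R.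
Variables (p : R) (m : nat).
Hypotheses (p1 : 1 <= p) (mTN : (16 * m * T <= N)%N) (mN : ((2 * m).+1 <= N)%N).
Local Notation W := (2 * m).+1.

Let mF l : measurable (cs_F S l : set (measurableTypeR R)) :=
  measurable_cs_F t0_gt0 t0N0 x_special l.

Let mass l : R := fine (mu (cs_F S l)).

Lemma cs_F_norm_le1 (l : nat) (y : R) : cs_F S l y -> `|y| <= 1.
Proof.
move=> /cs_FP[i [_ _ /andP[y1 y2]]].
have := @point_ge0 R N0 t0 n0 x l i.
have := @point_le1 R N0 t0 n0 x t0_gt0 t0N0 l i.
by move=> h1 h2; rewrite ger0_norm; lra.
Qed.

(** The cosine transform [G] has mean at least [4 a] over the [W ^ l] frequencies, where
    [a = mu(F_l) 2 ^ - l / 4]. Moving by at most [2 ^ - l / 32] from a frequency loses at most [a],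
    and the linear bound for [w ^ p] subtracts [2 a], which leaves [2 a ^ p] on average. The
    intervals are disjoint because the frequencies are distinct integers. *)
Lemma Lnorm_fourier_ge (l : nat) : 0 < mass l ->
  (((2 * ((2^-1) ^+ l / 32) * W%:R ^+ l * (mass l * (2^-1) ^+ l / 4) `^ p) `^ p^-1)%:E
    <= 'N[@lebesgue_measure R]_(p%:E)
         [EFin \o (fun xi => Normc.normc (fourier_fun mu (cs_f S l) xi))])%E.
Proof.
set v := mass l => v0.
set e : R := (2^-1) ^+ l.
have e0 : 0 < e by rewrite exprn_gt0.
have e1 : e <= 1 by rewrite exprn_ile1 // invf_le1 // ler1n.
set a := v * e / 4; have a0 : 0 < a by rewrite divr_gt0 // mulr_gt0.
have p0 : 0 < p := lt_le_trans ltr01 p1.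
pose k (n : nat) : R := (freq N m l n)%:R - (offset N m l)%:R.
pose G := trig_transform mu (cs_F S l) cos.
pose w n := Num.max 0 (G (k n) - a).
have F01 := @cs_F_norm_le1 l.
have lipG := trig_transform_lipschitz mu (mF l) F01
  (@continuous_cos R) (@cos_max R) (@cos_lipschitz R).
have sumG : 4 * a * W%:R ^+ l <= \sum_(n < W ^ l) G (k n).
  have intc n : mu.-integrable setT
      (EFin \o (fun y => \1_(cs_F S l) y * cos (- (2 * pi * y * k n)))).
    apply: integrable_indic_mul => //.
      by apply: measurable_trig; exact: continuous_cos.
    by move=> y; rewrite (le_trans (cos_max _)) // ler1n.
  rewrite -(@Rintegral_ord_sum _ _ _ mu _
    (fun n y => \1_(cs_F S l) y * cos (- (2 * pi * y * k n)))) //.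
  have -> : 4 * a * W%:R ^+ l = \int[mu]_y ((W%:R / 2) ^+ l * \1_(cs_F S l) y).
    rewrite RintegralZl //; last first.
      apply: (@bounded_integrable _ _ R mu _ _ 1) => //.
        by apply: (le_lt_trans (probability_le1 mu measurableT)); exact: ltry.
      by move=> y; rewrite indicE; case: (_ \in _); rewrite ?normr1 ?normr0.
    rewrite (Rintegral_indic_mass mu (mF l)) -/(mass l) -/v /a exprMn -/e.
    by field.
  apply: le_Rintegral => //.
  - have i3 : mu.-integrable setT (EFin \o (\1_(cs_F S l) : measurableTypeR R -> R)).
      apply: (@bounded_integrable _ _ R mu _ _ 1) => //.
        by apply: (le_lt_trans (probability_le1 mu measurableT)); exact: ltry.
      by move=> y; rewrite indicE; case: (_ \in _); rewrite ?normr1 ?normr0.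
    exact: (integrableZl measurableT ((W%:R / 2) ^+ l) i3).
  - have := @integrable_sum _ _ _ mu setT measurableT 'I_(W ^ l) (index_enum _) xpredT
      (fun n => EFin \o (fun y => \1_(cs_F S l) y * cos (- (2 * pi * y * k n))))
      (fun n _ => intc n).
    by apply: eq_integrable => // y _; rewrite /= sumEFin.
  move=> y _; rewrite -mulr_sumr indicE.
  have [Fy|_] := boolP (y \in _); last by rewrite mul0r mulr0.
  rewrite mul1r mulr1.
  apply: le_trans (sum_cos_freq_ge mTN (set_mem Fy)) _.
  rewrite le_eqVlt; apply/orP; left; apply/eqP; apply: eq_bigr => n _.
  by rewrite cosN.
have sumw : 2 * W%:R ^+ l * a `^ p <= \sum_(n < W ^ l) w n `^ p.
  apply: (@le_trans _ _ (\sum_(n < W ^ l) a `^ (p - 1) * (G (k n) - 2 * a))); last first.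
    by apply: ler_sum => n _; exact: powR_ge_tangent.
  rewrite -mulr_sumr sumrB sumr_const card_ord -[_ *+ (W ^ l)]mulr_natl natrX.
  rewrite -(@mulr_powRB1 _ a p) ?(ltW a0) //.
  have := ler_wpM2l (powR_ge0 a (p - 1)) sumG; lra.
apply: le_trans (Lnorm_ge_bumps (k := k) (w := w) (h := e / 32) (K := W ^ l) p0 _ _ _ _ _ _).
- rewrite lee_fin ge0_ler_powR ?nnegrE ?invr_ge0 ?(ltW p0) //.
  + by rewrite !mulr_ge0 ?powR_ge0 ?exprn_ge0 ?(ltW e0).
  + by rewrite mulr_ge0 ?divr_ge0 ?(ltW e0) // sumr_ge0 // => n _; exact: powR_ge0.
  have e32 : 0 <= e / 32 by rewrite divr_ge0 ?(ltW e0).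
  have := ler_wpM2l e32 sumw; lra.
- by rewrite divr_gt0.
- by apply: measurable_normc_fourier => //; exact: mF.
- by move=> xi; rewrite /Normc.normc /fourier_fun sqrtr_ge0.
- by move=> n; rewrite /w le_max lexx.
- move=> n1 n2 xi n1W n2W /andP[h1 h2] /andP[h3 h4].
  apply: (freq_inj mN n1W n2W).
  have lt n3 n4 : k n3 <= xi -> xi < k n4 + e / 32 -> (freq N m l n3 <= freq N m l n4)%N.
    move=> g1 g2; have : k n3 < k n4 + 1 by move: e1; lra.
    by rewrite /k -addrA [X in _ < _ + X]addrC addrA ltrD2r natr1 ltr_nat ltnS.
  by apply/eqP; rewrite eqn_leq !lt.
- move=> n xi nW /andP[h1 h2].
  have n0' : 0 <= Normc.normc (fourier_fun mu (cs_f S l) xi).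
    by rewrite /Normc.normc /fourier_fun sqrtr_ge0.
  rewrite /w ge_max n0' /=.
  apply: le_trans (trig_transform_le_normc mu (cs_F S l) xi).
  have := lipG (k n) xi; rewrite -/G -/(mass l) -/v => lip.
  have kx : `|k n - xi| <= e / 32 by rewrite distrC ger0_norm; lra.
  have : 8 * v * `|k n - xi| <= 8 * v * (e / 32) by rewrite ler_wpM2l //; lra.
  have := ler_norm (G (k n) - G xi); rewrite /a; lra.
Qed.

Lemma Lnorm_cs_f (q : R) (l : nat) : 0 < q ->
  ('N[mu]_(q%:E) [EFin \o cs_f S l])%E = (mass l `^ q^-1)%:E.
Proof.
move=> q0; rewrite Lnorm.unlock -poweR_EFin; congr (_ `^ _)%E.
rewrite /mass fineK ?fin_num_measure //.
transitivity (\int[mu]_y (\1_(cs_F S l) y)%:E)%E; last first.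
  by rewrite integral_indic ?setIT.
apply: eq_integral => y _; rewrite /cs_f /= indicE.
by case: (_ \in _); rewrite ?normr1 ?normr0 ?powR1 ?powR0 // gt_eqF.
Qed.

(** The lower bound for the numerator is linear in [v = mu(F_l)] and the denominator is [v ^ (1/q)].
    Since [q >= 1], the remaining [v ^ (1 - 1/q)] is bounded below through [v >= T ^ - (l + 1)], and
    the whole is geometric in [l]. *)
Lemma extension_ratio_ge (q : R) (l : nat) : 1 <= q ->
  T%:R ^- l.+1 <= mass l ->
  (((16^-1) `^ p^-1 / 4 / T%:R `^ (1 - q^-1) *
     ((W%:R / 2) `^ p^-1 / 2 / T%:R `^ (1 - q^-1)) ^+ l)%:E
    <= extension_ratio S mu p q l)%E.
Proof.
move=> q1 vT; set v := mass l in vT *.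
have T0 : (0 : R) < T%:R by rewrite ltr0n expn_gt0 t0_gt0.
have v0 : 0 < v by rewrite (lt_le_trans _ vT) // invr_gt0 exprn_gt0.
have q0 : 0 < q := lt_le_trans ltr01 q1.
have p0 : 0 < p := lt_le_trans ltr01 p1.
have q01 : 0 <= 1 - q^-1 by rewrite subr_ge0 invf_le1.
have b0 : 0 < v `^ q^-1 by exact: powR_gt0.
rewrite /extension_ratio Lnorm_cs_f // -/v inver gt_eqF // lee_pdivlMr //.
apply: le_trans (Lnorm_fourier_ge v0); rewrite -EFinM lee_fin -/v.
set tau := T%:R `^ (1 - q^-1).
have tau0 : 0 < tau by exact: powR_gt0.
have vtau : tau ^- l.+1 * v `^ q^-1 <= v.
  have {2}-> : v = v `^ (1 - q^-1) * v `^ q^-1.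
    by rewrite -powRD ?subrK ?powRr1 ?(ltW v0) // gt_eqF ?implybT.
  rewrite ler_wpM2r ?(ltW b0) // /tau -powR_exprn ?(ltW T0) // -powRN.
  rewrite -mulN1r powRrM powR_inv1 ?exprn_ge0 ?(ltW T0) //.
  by rewrite ge0_ler_powR ?nnegrE ?invr_ge0 ?exprn_ge0 ?(ltW v0) ?(ltW T0).
set e : R := (2^-1) ^+ l.
have e0 : 0 < e by rewrite exprn_gt0.
set c := (16^-1) `^ p^-1; set om := (W%:R / 2) `^ p^-1.
have -> : (2 * (e / 32) * W%:R ^+ l * (v * e / 4) `^ p) `^ p^-1 = c * om ^+ l * (v * e / 4).
  rewrite (_ : 2 * (e / 32) * W%:R ^+ l = 16^-1 * (W%:R / 2) ^+ l); last first.
    by rewrite exprMn -/e; field.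
  have w0 : 0 <= W%:R / 2 :> R by rewrite divr_ge0.
  have a0 : 0 <= v * e / 4 by rewrite divr_ge0 // mulr_ge0 ?ltW.
  move: (v * e / 4) a0 => a a0.
  rewrite powRM ?powR_ge0 ?mulr_ge0 ?exprn_ge0 // powRM ?exprn_ge0 //.
  by rewrite powR_exprn // -[X in _ * X]powRrM divff ?gt_eqF // powRr1.
have co : 0 <= c * om ^+ l * e / 4.
  by rewrite divr_ge0 // mulr_ge0 ?(ltW e0) // mulr_ge0 ?exprn_ge0 ?powR_ge0.
have := ler_wpM2l co vtau.
have -> : c * om ^+ l * e / 4 * v = c * om ^+ l * (v * e / 4) by ring.
apply: le_trans; rewrite le_eqVlt; apply/orP; left; apply/eqP.
rewrite !exprMn -/e exprVn exprS.
by field; rewrite expf_neq0 gt_eqF.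
Qed.

End extension_lower_bound.

(** * Choice of [n0] and conclusion *)

Lemma exists_exprn_ge (R : realType) (b C : R) : 1 < b ->
  exists n, (0 < n)%N /\ forall l, (n <= l)%N -> C <= b ^+ l.
Proof.
move=> b1; have db : 0 < b - 1 by rewrite subr_gt0.
have bern n : n%:R * (b - 1) <= b ^+ n.
  suff : 1 + n%:R * (b - 1) <= b ^+ n by lra.
  elim: n => [|n IH]; first by rewrite mul0r addr0 expr0.
  have b0 : 0 <= b by lra.
  have := ler_wpM2l b0 IH; rewrite exprS -natr1.
  have : 0 <= n%:R * (b - 1) * (b - 1) by rewrite !mulr_ge0 // ltW.
  lra.
exists (Num.truncn (C / (b - 1))).+1; split=> // l nl.
apply: le_trans (bern l); rewrite -ler_pdivrMr // (le_trans (ltW (truncnS_gt _))) //.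
by rewrite ler_nat.
Qed.

Lemma succ_double_le (M k : nat) : (16 * k <= M)%N -> (0 < M)%N -> ((2 * k).+1 <= M)%N.
Proof. lia. Qed.

Unset Implicit Arguments.

Theorem theorem3 (R : realType) (N0 t0 : nat) (alpha p q : R) :
  (1 < t0)%N -> (t0 < N0)%N ->
  alpha = ln t0%:R / ln N0%:R ->
  1 <= p -> 1 <= q ->
  (1 < q -> p < q * (2 - alpha) / (alpha * (q - 1))) ->
  exists (n0 : nat) (S : cantor_system R N0 t0 n0)
         (mu : probability (measurableTypeR R) R),
    [/\ (0 < n0)%N,
        cantor_measure S mu,
        forall beta : R, 0 < beta < alpha ->
          fourier_decay mu beta /\ uniform_fourier_decay S beta
      & extension_ratio S mu p q l @[l --> \oo] --> +oo%E].
Proof.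
move=> t1 tN alphaE p1 q1 pq.
have t0_gt0 : (0 < t0)%N := ltnW t1.
have t0N0 : (t0 <= N0)%N := ltnW tN.
have N0_gt0 : (0 < N0)%N := leq_trans t0_gt0 t0N0.
have tr : (0 : R) < t0%:R by rewrite ltr0n.
have Nr : (0 : R) < N0%:R by rewrite ltr0n.
have lt0 : 0 < ln (t0%:R : R) by rewrite ln_gt0 // ltr1n.
have lN0 : 0 < ln (N0%:R : R) by rewrite ln_gt0 // ltr1n (leq_trans t1).
have ltN : ln (t0%:R : R) < ln N0%:R by rewrite ltr_ln ?posrE // ltr_nat.
have al0 : 0 < alpha by rewrite alphaE divr_gt0.
have al1 : alpha < 1 by rewrite alphaE ltr_pdivrMr // mul1r.
have alN : alpha * ln N0%:R = ln t0%:R by rewrite alphaE divfK // gt_eqF.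
have q0 : 0 < q := lt_le_trans ltr01 q1.
have p0 : 0 < p := lt_le_trans ltr01 p1.
pose u := 1 - q^-1.
have u0 : 0 <= u by rewrite subr_ge0 invf_le1.
(* The hypothesis on [p] in a form that also covers [q = 1], where [u = 0]. *)
have gam : alpha * (1 + p * u) < 2.
  have [q1'|q1'] := leP q 1.
    have qe : q = 1 by apply/eqP; rewrite eq_le q1'.
    by rewrite /u qe invr1 subrr mulr0; lra.
  have := pq q1'; rewrite ltr_pdivlMr ?mulr_gt0 ?subr_gt0 // => h.
  have -> : alpha * (1 + p * u) = alpha + p * (alpha * (q - 1)) / q.
    by rewrite /u; field; rewrite gt_eqF.
  by rewrite -ltrBrDl ltr_pdivrMr // [ltRHS]mulrC.
(* [b ^ n0] is [N / T ^ (1 + p u)], and [b > 1] is the previous inequality after taking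
   logarithms. *)
pose b : R := N0%:R ^+ 2 / t0%:R `^ (1 + p * u).
have tg0 : 0 < t0%:R `^ (1 + p * u) :> R by exact: powR_gt0.
have b1 : 1 < b.
  rewrite /b ltr_pdivlMr // mul1r -ltr_ln ?posrE ?exprn_gt0 //.
  rewrite ln_powR lnXn // -[ln N0%:R *+ 2]mulr_natl -alN mulrA ltr_pM2r // mulrC.
  exact: gam.
(* In the constant, 16 comes from [m], 2 from [W / 2], and [2 ^ p] from the division by 2 in the
   geometric ratio. *)
have [n0 [n0_gt0 /(_ n0 (leqnn n0)) bn]] := exists_exprn_ge (32 * 2 `^ p) b1.
set T := (t0 ^ n0)%N; set N := sys_param N0 n0.
have T1 : (1 < T)%N by rewrite -(exp1n n0) ltn_exp2r.
have Tr : (0 : R) < T%:R by rewrite ltr0n ltnW.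
have N_gt0 : (0 < N)%N by rewrite expn_gt0 N0_gt0.
have NR : (0 : R) < N%:R by rewrite ltr0n.
have [x [x_special x_bal]] := balanced_addresses R N_gt0 (ltnW T1) (sys_paramE t0 n0).
have [mu [muS muF]] := exists_cantor_measure R t0_gt0 t0N0 x_special T1.
set S := shift_system _ _ _ _ in muS muF.
exists n0, S, mu; split=> //.
  move=> beta /andP[be0 beal].
  have decay l := @coefficient_decay R N (sys_param t0 n0) T x N_gt0 (ltnW T1)
    (sys_paramE t0 n0) x_bal (beta / 2) l _ _.
  have be01 : 0 <= beta / 2 <= 1 by apply/andP; split; lra.
  (* [T = N ^ (alpha / 2)] and [beta < alpha]. *)
  have NT : N%:R `^ (beta / 2) < T%:R :> R.
    rewrite -ltr_ln ?posrE ?powR_gt0 // ln_powR /N /T /sys_param !natrX !lnXn //.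
    rewrite -[_ *+ (2 * n0)]mulr_natl -[_ *+ n0]mulr_natl natrM -alN.
    have n0r : (0 : R) < n0%:R by rewrite ltr0n.
    have := mulr_gt0 n0r lN0; nra.
  split; last by apply: uniform_fourier_decay_shift_system => l; exact: decay.
  apply: fourier_decay_weak_limit muS.1 => l; exact: decay.
pose m := (N %/ (16 * T))%N.
have mTN : (16 * m * T <= N)%N by rewrite mulnAC mulnC leq_divM.
have mN : ((2 * m).+1 <= N)%N.
  have m16 : (16 * m <= N)%N by rewrite (leq_trans _ mTN) // leq_pmulr // ltnW.
  exact: succ_double_le.
have vT l : T%:R ^- l.+1 <= fine (mu (cs_F S l)).
  by rewrite -lee_fin fineK ?muF // fin_num_measure //; exact: measurable_cs_F.
have ge l := extension_ratio_ge p1 mTN mN q1 (vT l).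
set tau : R := T%:R `^ (1 - q^-1) in ge.
have tau0 : 0 < tau by exact: powR_gt0.
set rho : R := _ / 2 / tau in ge; set kap : R := _ / 4 / tau in ge.
have kap0 : 0 < kap by rewrite !divr_gt0 // powR_gt0.
have rho1 : 1 < rho.
  have NE : N%:R = (N0%:R ^+ 2) ^+ n0 :> R by rewrite /N /sys_param natrX -exprM.
  have TE : T%:R `^ (1 + p * u) = (t0%:R `^ (1 + p * u)) ^+ n0.
    by rewrite /T natrX powR_exprn // ltW.
  have big : 32 * 2 `^ p * T%:R `^ (1 + p * u) <= N%:R.
    rewrite TE NE -ler_pdivlMr ?exprn_gt0 //.
    by move: bn; rewrite /b expr_div_n.
  have mlt : N%:R < m.+1%:R * (16 * T%:R) :> R.
    rewrite -[16 * T%:R]/(16%:R * T%:R) -!natrM ltr_nat.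
    by rewrite /m ltn_ceil // muln_gt0 (ltnW T1).
  (* The [p]-th power of [rho > 1]: it follows from [m + 1 > N / (16 T)], the choice of [n0] and
     [W >= m + 1]. *)
  have WX : (2 * tau) `^ p < (2 * m).+1%:R / 2.
    rewrite powRM ?(ltW tau0) // /tau -powRrM -/u [u * p]mulrC.
    have : 2 * (2 `^ p * T%:R `^ (p * u)) < m.+1%:R.
      rewrite -(ltr_pM2r (_ : 0 < 16 * T%:R)) ?mulr_gt0 //.
      apply: le_lt_trans mlt; apply: le_trans big.
      rewrite powRD ?(lt0r_neq0 Tr) ?implybT // powRr1 ?(ltW Tr) //.
      by rewrite le_eqVlt; apply/orP; left; apply/eqP; ring.
    have : m.+1%:R <= (2 * m).+1%:R :> R by rewrite ler_nat ltnS leq_pmull.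
    lra.
  rewrite /rho ltr_pdivlMr // ltr_pdivlMr // mul1r mulrC.
  have p20 : 0 < 2 * tau by rewrite mulr_gt0.
  have <- : ((2 * tau) `^ p) `^ p^-1 = 2 * tau.
    by rewrite -powRrM divff ?gt_eqF // powRr1 // ltW.
  by apply: gt0_ltr_powR; rewrite ?invr_gt0 ?nnegrE ?powR_ge0 ?divr_ge0.
apply/cvgeyPge => A.
have [n1 [_ Hn1]] := exists_exprn_ge (A / kap) rho1.
exists n1 => // l /= nl; apply: le_trans (ge l).
by rewrite lee_fin mulrC -ler_pdivrMr // Hn1.
Qed.
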